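(* Let $\phi\in\mathbb{Q}(x)$ be a rational function of degree $2$ having a $2$-periodic critical point, and suppose that $\operatorname{Aut}(\phi)$ is trivial. Then there exists $v\in\mathbb{Q}\setminus\{0\}$ such that $\phi$ is linearly conjugate over $\mathbb{Q}$ to \[\phi_v:=\frac{v(x-1)}{x^2}.\] Moreover, for any such $v$ with $v\neq 3$: if $v\in\operatorname{Im}\eta$, then $G_{3,\phi}\cong C$; otherwise $G_{3,\phi}\cong(\mathbb{Z}/3\mathbb{Z})\wr S_2$.
   Context: The degree of a rational function $\phi=p/q$ with $p,q$ coprime polynomials is $\max\{\deg p,\deg q\}$; $\phi$ induces a map $\mathbb{P}^1(\overline{\mathbb{Q}})\to\mathbb{P}^1(\overline{\mathbb{Q}})$. A point $P$ is $n$-periodic if $\phi^n(P)=P$ and $n$ is the least such positive integer ($\phi^n$ = $n$-fold composition). A critical point is a point of $\mathbb{P}^1(\overline{\mathbb{Q}})$ at which the morphism $\phi:\mathbb{P}^1\to\mathbb{P}^1$ ramifies. Two rational functions $\phi,\psi\in\mathbb{Q}(x)$ are linearly conjugate over a field $K$ if $\psi=\sigma^{-1}\circ\phi\circ\sigma$ for some degree-one $\sigma\in K(x)$. $\operatorname{Aut}(\phi)$ is the group of degree-one $\sigma\in\overline{\mathbb{Q}}(x)$ with $\sigma^{-1}\circ\phi\circ\sigma=\phi$. The $3$rd dynatomic group $G_{3,\phi}$ is $\operatorname{Gal}(\mathbb{Q}_{3,\phi}/\mathbb{Q})$, where $\mathbb{Q}_{3,\phi}$ is the compositum of the fields of definition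 $\mathbb{Q}(P)$ of all $3$-periodic points $P\in\mathbb{P}^1(\overline{\mathbb{Q}})$ of $\phi$ (with $\mathbb{Q}(\infty)=\mathbb{Q}$). Let $\eta(t)=\dfrac{t^3+3t^2-6t+1}{t(t-1)}\in\mathbb{Q}(t)$ and $\operatorname{Im}\eta=\{\eta(u):u\in\mathbb{Q}\setminus\{0,1\}\}$. Let $C$ be the subgroup of the symmetric group $S_6$ generated by $(1,6)(2,4)(3,5)$ and $(1,2,3)(4,6,5)$ (it is isomorphic to $S_3$). The wreath product $(\mathbb{Z}/3\mathbb{Z})\wr S_2$ may be realized as the centralizer of $(1,2,3)(4,5,6)$ in $S_6$. *)

(* Defs.v *)
From HB Require Import structures.
From mathcomp Require Import all_boot all_order all_algebra all_fingroup all_field.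
Set Implicit Arguments. Unset Strict Implicit. Unset Printing Implicit Defensive.
Import GRing.Theory Num.Theory.
Local Open Scope ring_scope.

(* A rational function p/q over a field F, represented by the pair (p, q). *)
Definition rfun (F : fieldType) := ({poly F} * {poly F})%type.

Definition rdeg (F : fieldType) (phi : rfun F) : nat := maxn (size phi.1).-1 (size phi.2).-1.

Definition is_rfun (F : fieldType) (phi : rfun F) : bool := coprimep phi.1 phi.2 && (phi.2 != 0).

Definition ratC (phi : rfun rat) : rfun algC :=
  (map_poly ratr phi.1, map_poly ratr phi.2).

(* Points of P^1(F): Some a = a, None = infinity.
   Induced map P^1 -> P^1 (using the homogenisation of degree d = rdeg phi
   at infinity). *)
Definition rf_eval (F : fieldType) (phi : rfun F) (P : option F) : option F :=
  let p := phi.1 in let q := phi.2 in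
  match P with
  | Some a => if q.[a] != 0 then Some (p.[a] / q.[a]) else None
  | None => let d := rdeg phi in
            if q`_d != 0 then Some (p`_d / q`_d) else None
  end.

Definition is_periodic (T : eqType) (f : T -> T) (n : nat) (P : T) : Prop :=
  (0 < n)%N /\ iter n f P = P /\ (forall m, (0 < m < n)%N -> iter m f P <> P).

(* numerator of the derivative of u/v *)
Definition wr (F : fieldType) (u v : {poly F}) : {poly F} := u^`() * v - u * v^`().

Definition revd (F : fieldType) (d : nat) (p : {poly F}) : {poly F} := \poly_(i < d.+1) p`_(d - i).

(* P is a critical (ramification) point of phi: the derivative of phi in local
   coordinates (x or 1/x at the source, y or 1/y at the target) vanishes. *)
Definition is_critical (F : fieldType) (phi : rfun F) (P : option F) : Prop :=
  let p := phi.1 in let q := phi.2 in let d := rdeg phi in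
  match P with
  | Some a => if q.[a] != 0 then (wr p q).[a] = 0 else (wr q p).[a] = 0
  | None => let p' := revd d p in let q' := revd d q in
      if q'.[0] != 0 then (wr p' q').[0] = 0 else (wr q' p').[0] = 0
  end.

(* homogenised composition: numerator (or denominator) of phi((a x + b)/(c x + e)),
   multiplied by (c x + e)^d *)
Definition hom_comp (F : fieldType) (d : nat) (p : {poly F}) (a b c e : F) : {poly F} :=
  \sum_(i < d.+1) p`_i *: ((a *: 'X + b%:P) ^+ i * (c *: 'X + e%:P) ^+ (d - i)).

(* psi = sigma^{-1} o phi o sigma, sigma = (a x + b)/(c x + e), a e - b c <> 0,
   sigma^{-1} = (e y - b)/(- c y + a); equality of rational functions by
   cross-multiplication. *)
Definition lin_conj_by (F : fieldType) (phi psi : rfun F) (a b c e : F) : Prop :=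
  a * e - b * c != 0 /\
  let d := rdeg phi in
  let U := hom_comp d phi.1 a b c e in let V := hom_comp d phi.2 a b c e in
  psi.1 * (a *: V - c *: U) = psi.2 * (e *: U - b *: V).

Definition Qconj (phi psi : rfun rat) : Prop :=
  exists a b c e : rat, lin_conj_by phi psi a b c e.

Definition aut_trivial (phi : rfun algC) : Prop :=
  forall a b c e : algC, lin_conj_by phi phi a b c e -> b = 0 /\ c = 0 /\ a = e.

Definition phi_v (v : rat) : rfun rat := (v *: ('X - 1), 'X^2).

Definition in_eta (v : rat) : Prop :=
  exists u : rat, u != 0 /\ u != 1 /\
    v = (u ^+ 3 + 3 * u ^+ 2 - 6 * u + 1) / (u * (u - 1)).

(* K (a subfield of a splitting field L over Q, embedded into Qbar = algC by emb)
   is the compositum Q_{3,phi} of the fields Q(P), P a 3-periodic point of phi: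
   the smallest subfield whose image contains all finite 3-periodic points. *)
Definition is_Q3field (phi : rfun rat) (L : splittingFieldType rat)
    (emb : {rmorphism L -> algC}) (K : {subfield L}) : Prop :=
  let f := rf_eval (ratC phi) in
  (forall a : algC, is_periodic f 3 (Some a) -> exists2 x, x \in K & emb x = a) /\
  (forall E : {subfield L},
     (forall a : algC, is_periodic f 3 (Some a) -> exists2 x, x \in E & emb x = a) ->
     (K <= E)%VS).

(* Points 1..6 are the ordinals 0..5 of 'I_6. *)
Definition pt (i : nat) : 'I_6 := inord i.-1.

Definition gC1 : {perm 'I_6} := (tperm (pt 1) (pt 6) * tperm (pt 2) (pt 4) * tperm (pt 3) (pt 5))%g.
(* (1,2,3)(4,6,5); note (s * t) x = t (s x), and (a b c) = tperm a b * tperm a c *)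
Definition gC2 : {perm 'I_6} :=
  (tperm (pt 1) (pt 2) * tperm (pt 1) (pt 3) * (tperm (pt 4) (pt 6) * tperm (pt 4) (pt 5)))%g.
Definition Cgrp : {set {perm 'I_6}} := <<[set gC1; gC2]>>%g.

(* (1,2,3)(4,5,6) and the wreath product (Z/3) wr S_2 as its centralizer in S_6 *)
Definition gW : {perm 'I_6} :=
  (tperm (pt 1) (pt 2) * tperm (pt 1) (pt 3) * (tperm (pt 4) (pt 5) * tperm (pt 4) (pt 6)))%g.
Definition Wgrp : {set {perm 'I_6}} := 'C[gW]%g.

(* Main.v *)
Require Import Defs.
From HB Require Import structures.
From mathcomp Require Import all_boot all_order all_algebra all_fingroup all_field.
From mathcomp Require Import cyclic pgroup ring lra zify.
Set Implicit Arguments. Unset Strict Implicit. Unset Printing Implicit Defensive.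
Import GRing.Theory Num.Theory.
Local Open Scope ring_scope.

(** Put the critical 2-cycle at (0, oo): the normal form is (n1 x + n0) / (d x^2), and n1 = 0
    would give the automorphisms x -> zeta_3 x. For n1 <> 0 the scaled map phi_v has (0, oo) as
    its only 2-cycle and oo is not critical, so every automorphism of algC fixes the critical
    point of phi, which is therefore rational.

    The dynatomic sextic of phi_v is g_w g_{w^2} with g_w = x^3 - v x^2 + v (1 - w) x + v w and
    w a primitive cube root of unity. Substituting u = 1 - (1 - w) / x turns g_w = 0 into
    u^3 = alpha := 1 - 3 (1 - w) / v, so that the field of 3-periodic points is
    Q(w, A, B) with A^3 = alpha and B^3 = conj alpha. By Kummer theory over Q(w) it remains to
    see which of alpha, alpha conj(alpha), alpha / conj(alpha) are cubes in Q(w). A cube among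
    the first two makes the norm (1 - 3/v)^3 + (3/v)^3 of alpha a rational cube, which Fermat's
    theorem for exponent 3 forbids when v <> 3; by Hilbert 90 the third is a cube exactly when
    v is a value of eta. *)

(** * Quadratic maps in homogeneous coordinates *)

(** Why v = 3 is set apart: there alpha = w, and its norm 1 = 0^3 + 1^3 is a cube through a trivial
    solution of Fermat's equation. Where eta comes from: for c' = r + s w, the condition that alpha
    c'^3 be rational is linear in v, and its solution, written with r / s = 1 - u, is eta(u).

    The Galois group is made to permute the six cube roots of alpha and conj(alpha) rather than the
    3-periodic points. On them phi_v becomes u -> w u over alpha and u -> w^2 u over conj(alpha).
    This permutation commutes with Galois because phi_v is rational, so the group embeds in [Wgrp]
    in all cases. Kummer theory then becomes a counting argument: Gal(K / Q(w)) is a 3-group, so it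
    has order at least 9 once it is not cyclic, and the factor 2 coming from Q(w) reaches the bound
    18. When v is a value of eta, A and B generate the same extension of Q(w), and a suitable choice
    of B among its three conjugates makes the action literally that of C. *)

Definition qform (R : pzRingType) (p2 p1 p0 x y : R) : R :=
  p2 * x ^+ 2 + p1 * (x * y) + p0 * y ^+ 2.

(** The pair (0, 0) goes to infinity by default; the lemmas that recover a pair from its point
    assume it nonzero. *)
Definition proj_pt (F : fieldType) (x y : F) : option F :=
  if y == 0 then None else Some (x / y).

Definition ptx (F : fieldType) (P : option F) : F := if P is Some a then a else 1.
Definition pty (F : fieldType) (P : option F) : F := if P is Some _ then 1 else 0.

Definition moebius (F : fieldType) (a b c e : F) (P : option F) : option F :=
  proj_pt (a * ptx P + b * pty P) (c * ptx P + e * pty P).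

Lemma qformZ (R : comPzRingType) (p2 p1 p0 k x y : R) :
  qform p2 p1 p0 (k * x) (k * y) = k ^+ 2 * qform p2 p1 p0 x y.
Proof. by rewrite /qform; ring. Qed.

Section Homogeneous.
Variable F : fieldType.
Implicit Types (x y : F) (P Q : option F) (phi : rfun F) (p : {poly F}).

Lemma proj_ptK P : proj_pt (ptx P) (pty P) = P.
Proof. by case: P => [a|]; rewrite /proj_pt /= ?eqxx // oner_eq0 divr1. Qed.

Lemma pt_neq0 P : (ptx P != 0) || (pty P != 0).
Proof. by case: P => [a|] /=; rewrite oner_eq0 ?orbT. Qed.

Lemma proj_ptZ k x y : k != 0 -> proj_pt (k * x) (k * y) = proj_pt x y.
Proof.
move=> k0; rewrite /proj_pt mulf_eq0 (negPf k0) /=.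
by case: eqP => // /eqP y0; rewrite invfM mulrACA divff // mul1r.
Qed.

Lemma proj_ptP x y : (x != 0) || (y != 0) ->
  exists2 k, k != 0 & x = k * ptx (proj_pt x y) /\ y = k * pty (proj_pt x y).
Proof.
rewrite /proj_pt; case: (eqVneq y 0) => [->|y0] h.
  exists x; first by move: h; rewrite orbF.
  by rewrite /= mulr1 mulr0.
by exists y; rewrite //= mulr1 mulrC divfK.
Qed.

Lemma coef_deg2 p i : (size p <= 3)%N ->
  p`_i = (p`_2 *: 'X^2 + p`_1 *: 'X + (p`_0)%:P)`_i.
Proof.
move=> sp; rewrite !coefD !coefZ coefXn coefX coefC.
case: i => [|[|[|i]]]; rewrite /= ?(mulr0, mulr1, add0r, addr0) //.
by rewrite nth_default // (leq_trans sp).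
Qed.

Lemma poly_deg2 p : (size p <= 3)%N ->
  p = p`_2 *: 'X^2 + p`_1 *: 'X + (p`_0)%:P.
Proof. by move=> sp; apply/polyP => i; apply: coef_deg2. Qed.

Lemma horner_deg2 p x : (size p <= 3)%N -> p.[x] = qform p`_2 p`_1 p`_0 x 1.
Proof. move=> /poly_deg2 {1}->; rewrite !(hornerD, hornerZ, hornerXn, hornerX, hornerC) /qform; ring. Qed.

Lemma rdeg2_size phi : rdeg phi = 2%N -> (size phi.1 <= 3)%N && (size phi.2 <= 3)%N.
Proof.
rewrite /rdeg => h.
have: ((size phi.1).-1 <= 2)%N && ((size phi.2).-1 <= 2)%N by rewrite -geq_max h.
by case: (size phi.1) => [|n]; case: (size phi.2).
Qed.

Lemma rdeg2_lead phi : rdeg phi = 2%N -> (phi.1`_2 != 0) || (phi.2`_2 != 0).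
Proof.
move=> h; have /andP [s1 s2] := rdeg2_size h.
apply: contraT; rewrite negb_or !negbK => /andP [/eqP h1 /eqP h2].
have H (p : {poly F}) : (size p <= 3)%N -> p`_2 = 0 -> (size p <= 2)%N.
  move=> sp p2; apply/leq_sizeP => j; rewrite leq_eqVlt => /orP [/eqP <- //|hj].
  by move/leq_sizeP: sp; apply.
have := H _ s1 h1; have := H _ s2 h2; move: h; rewrite /rdeg.
by case: (size phi.1) => [|[|[|n]]]; case: (size phi.2) => [|[|[|k]]].
Qed.

Lemma coprime_horner_neq0 (p q : {poly F}) x :
  coprimep p q -> (p.[x] != 0) || (q.[x] != 0).
Proof.
move=> cpq; case: (eqVneq p.[x] 0) => //= px.
by have := coprimep_root cpq (introT eqP px : root p x).
Qed.

Definition numh phi := qform phi.1`_2 phi.1`_1 phi.1`_0.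
Definition denh phi := qform phi.2`_2 phi.2`_1 phi.2`_0.

Lemma rf_eval_proj phi x y : rdeg phi = 2%N -> (x != 0) || (y != 0) ->
  rf_eval phi (proj_pt x y) = proj_pt (numh phi x y) (denh phi x y).
Proof.
move=> d2 xy; have /andP [s1 s2] := rdeg2_size d2.
have [k k0 [xE yE]] := proj_ptP xy.
move: (proj_pt x y) xE yE => P -> ->.
rewrite /numh /denh !qformZ proj_ptZ ?expf_neq0 //.
case: P => [a|] /=; rewrite ?d2 /proj_pt.
  by rewrite -!horner_deg2 // if_neg.
by rewrite /qform !(mulr1, mulr0, expr1n, expr0n, addr0) if_neg.
Qed.

Lemma forms_neq0 phi x y : is_rfun phi -> rdeg phi = 2%N ->
  (x != 0) || (y != 0) -> (numh phi x y != 0) || (denh phi x y != 0).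
Proof.
move=> /andP [cpq _] d2 xy; have /andP [s1 s2] := rdeg2_size d2.
have [k k0 [xE yE]] := proj_ptP xy; move: (proj_pt x y) xE yE => P -> ->.
rewrite /numh /denh !qformZ !(mulf_eq0 (k ^+ 2)) !(negPf (expf_neq0 2 k0)) /=.
case: P => [a|] /=.
  by rewrite -!horner_deg2 //; exact: coprime_horner_neq0.
by rewrite /qform !(mulr1, mulr0, expr1n, expr0n, addr0); exact: rdeg2_lead.
Qed.

Lemma rf_evalP phi P : is_rfun phi -> rdeg phi = 2%N ->
  exists2 k, k != 0 &
    numh phi (ptx P) (pty P) = k * ptx (rf_eval phi P) /\
    denh phi (ptx P) (pty P) = k * pty (rf_eval phi P).
Proof.
move=> hphi d2; have := rf_eval_proj d2 (pt_neq0 P); rewrite proj_ptK => ->.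
exact: proj_ptP (forms_neq0 hphi d2 (pt_neq0 P)).
Qed.

(** In each chart the numerator of the derivative is, up to sign, a dehomogenisation of one
    quadratic form, the Jacobian of the pair of forms. Exchanging numerator and denominator only
    changes its sign, and [revd] gives the chart 1/x at infinity. *)
Lemma critical_jacobian phi P : rdeg phi = 2%N -> is_critical phi P ->
  let p := phi.1 in let q := phi.2 in
  qform (p`_2 * q`_1 - p`_1 * q`_2) ((p`_2 * q`_0 - p`_0 * q`_2) *+ 2)
        (p`_1 * q`_0 - p`_0 * q`_1) (ptx P) (pty P) = 0.
Proof.
move=> d2; have /andP [s1 s2] := rdeg2_size d2.
have wrC (u v : {poly F}) : wr v u = - wr u v by rewrite /wr; ring.
have wrE (u v : {poly F}) x : (size u <= 3)%N -> (size v <= 3)%N -> (wr u v).[x] =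
  qform (u`_2 * v`_1 - u`_1 * v`_2) ((u`_2 * v`_0 - u`_0 * v`_2) *+ 2)
        (u`_1 * v`_0 - u`_0 * v`_1) x 1.
  move=> su sv; rewrite /wr {1 2}(poly_deg2 su) {1 2}(poly_deg2 sv).
  rewrite !(derivD, derivZ, derivXn, derivX, derivC) !(hornerD, hornerN, hornerM, hornerMn, hornerZ, hornerXn, hornerX, hornerC) /=.
  by rewrite /qform; ring.
have revE (u : {poly F}) : (size u <= 3)%N -> revd 2 u = u`_0 *: 'X^2 + u`_1 *: 'X + (u`_2)%:P.
  move=> su; rewrite (@poly_deg2 (revd 2 u)) ?size_poly //.
  by rewrite /revd !coef_poly.
case: P => [a|] /=.
  case: ifP => _; first by rewrite wrE.
  by rewrite wrC hornerN wrE // => /eqP; rewrite oppr_eq0 => /eqP.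
rewrite d2; set u := revd 2 _; set v := revd 2 _.
have h : (wr u v).[0] = 0 -> qform
  (phi.1`_2 * phi.2`_1 - phi.1`_1 * phi.2`_2)
  ((phi.1`_2 * phi.2`_0 - phi.1`_0 * phi.2`_2) *+ 2)
  (phi.1`_1 * phi.2`_0 - phi.1`_0 * phi.2`_1) 1 0 = 0.
  rewrite wrE ?size_poly // /u /v !revE // !(coefD, coefZ, coefXn, coefX, coefC) /=.
  rewrite /qform !(mulr0, mulr1, addr0, add0r, expr0n, expr1n) /= => e.
  by rewrite -[RHS]e; ring.
by case: ifP => _ //; rewrite wrC hornerN => /eqP; rewrite oppr_eq0 => /eqP.
Qed.
End Homogeneous.

(** * Conjugation to the normal form *)

Definition phi_normal (F : fieldType) (v : F) : rfun F := (v *: ('X - 1), 'X^2).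

(** The polarisation of [qform]: the coefficient of l m in the expansion of the form at l (x, y) + m
    (z, t). *)
Definition qpolar (R : pzRingType) (p2 p1 p0 x y z t : R) : R :=
  p2 * (x * z) *+ 2 + p1 * (x * t + z * y) + p0 * (y * t) *+ 2.

(* The conjugate of phi by (a x + b) / (c x + e) is (n1 x + n0) / (d x ^ 2). *)
Definition conj_coefs (F : fieldType) (phi : rfun F) (a b c e n1 n0 d : F) : Prop :=
  let p2 := phi.1`_2 in let p1 := phi.1`_1 in let p0 := phi.1`_0 in
  let q2 := phi.2`_2 in let q1 := phi.2`_1 in let q0 := phi.2`_0 in
  [/\ e * qform p2 p1 p0 a c - b * qform q2 q1 q0 a c = 0,
      e * qpolar p2 p1 p0 a c b e - b * qpolar q2 q1 q0 a c b e = n1 &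
      e * qform p2 p1 p0 b e - b * qform q2 q1 q0 b e = n0] /\
  [/\ a * qform q2 q1 q0 a c - c * qform p2 p1 p0 a c = d,
      a * qpolar q2 q1 q0 a c b e - c * qpolar p2 p1 p0 a c b e = 0 &
      a * qform q2 q1 q0 b e - c * qform p2 p1 p0 b e = 0].

Section NormalForm.
Variable F : fieldType.
Implicit Types (phi : rfun F) (P Q : option F) (a b c e : F).

(** Stated over any commutative ring under F so that it serves for polynomials, with [polyC], and
    for values at points, with [idfun]. *)
Lemma conj_forms phi a b c e n1 n0 d : conj_coefs phi a b c e n1 n0 d ->
  forall (R : comNzRingType) (f : {rmorphism F -> R}) (s t : R),
  let x := f a * s + f b * t in let y := f c * s + f e * t in
  let U := qform (f phi.1`_2) (f phi.1`_1) (f phi.1`_0) x y in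
  let V := qform (f phi.2`_2) (f phi.2`_1) (f phi.2`_0) x y in
  f e * U - f b * V = f n1 * (s * t) + f n0 * t ^+ 2 /\
  f a * V - f c * U = f d * s ^+ 2.
Proof.
move=> [[e2 e1 e0] [g2 g1 g0]] R f s t x y U V.
have E p2 p1 p0 q2 q1 q0 g h :
    f h * qform (f p2) (f p1) (f p0) x y - f g * qform (f q2) (f q1) (f q0) x y =
    f (h * qform p2 p1 p0 a c - g * qform q2 q1 q0 a c) * s ^+ 2 +
    f (h * qpolar p2 p1 p0 a c b e - g * qpolar q2 q1 q0 a c b e) * (s * t) +
    f (h * qform p2 p1 p0 b e - g * qform q2 q1 q0 b e) * t ^+ 2.
  by rewrite /x /y /qform /qpolar; ring.
by rewrite /U /V !E e2 e1 e0 g2 g1 g0 !rmorph0 !(mul0r, add0r, addr0).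
Qed.

Lemma hom_comp2 (p : {poly F}) a b c e : hom_comp 2 p a b c e =
  qform (p`_2)%:P (p`_1)%:P (p`_0)%:P (a%:P * 'X + b%:P * 1) (c%:P * 'X + e%:P * 1).
Proof.
rewrite /hom_comp !big_ord_recr big_ord0 /= /qform -!mul_polyC !expr1 !expr0.
by rewrite add0r; ring.
Qed.

Lemma conj_coefs_linear phi a b c e n1 n0 d : rdeg phi = 2%N ->
  a * e - b * c != 0 -> conj_coefs phi a b c e n1 n0 d -> d != 0 -> n1 = - n0 ->
  lin_conj_by phi (phi_normal (n1 / d)) a b c e.
Proof.
move=> d2 det cf d0 n1E; split=> //=; rewrite d2 !hom_comp2 -!mul_polyC.
have /= [-> ->] := conj_forms cf (polyC : {rmorphism F -> {poly F}}) 'X 1.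
rewrite /phi_normal /= polyCM n1E polyCN !expr1n !mulr1.
have: (d^-1)%:P * d%:P = 1 :> {poly F} by rewrite -polyCM mulVf.
move: (d^-1)%:P => D hD; rewrite mulrA; rewrite [_ * d%:P](_ : _ = - n0%:P * ('X - 1) * (D * d%:P)); last by ring.
by rewrite hD; ring.
Qed.

(** Precomposing sigma with x -> k x multiplies n1 / n0 by k. This freedom is what allows n1 = - n0,
    the shape of [phi_normal]. *)
Lemma conj_coefs_scale phi a b c e n1 n0 d k : conj_coefs phi a b c e n1 n0 d ->
  conj_coefs phi (k * a) b (k * c) e (k * n1) n0 (k ^+ 3 * d).
Proof.
move=> [[e2 e1 e0] [g2 g1 g0]].
have Q2 p2 p1 p0 : qform p2 p1 p0 (k * a) (k * c) = k ^+ 2 * qform p2 p1 p0 a c.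
  exact: qformZ.
have Q1 p2 p1 p0 : qpolar p2 p1 p0 (k * a) (k * c) b e = k * qpolar p2 p1 p0 a c b e.
  by rewrite /qpolar; ring.
split; split => //; rewrite ?Q2 ?Q1.
- by rewrite !(mulrCA _ (k ^+ 2)) -mulrBr e2 mulr0.
- by rewrite !(mulrCA _ k) -mulrBr e1.
- by rewrite -g2; ring.
- by rewrite !(mulrCA _ k) -mulrBr -!mulrA -mulrBr g1 !mulr0.
- by rewrite -!mulrA -mulrBr g0 mulr0.
Qed.

(** Equality of rational functions determines the conjugated pair of forms only up to a common
    factor, here [k]. *)
Lemma linear_conj_coefs phi v a b c e : rdeg phi = 2%N -> v != 0 ->
  lin_conj_by phi (phi_normal v) a b c e ->
  exists k, conj_coefs phi a b c e (k * v) (- (k * v)) k.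
Proof.
move=> d2 v0 [det] /=; rewrite d2 !hom_comp2 -!mul_polyC /phi_normal /=.
pose p := phi.1; pose q := phi.2.
pose N2 := e * qform p`_2 p`_1 p`_0 a c - b * qform q`_2 q`_1 q`_0 a c.
pose N1 := e * qpolar p`_2 p`_1 p`_0 a c b e - b * qpolar q`_2 q`_1 q`_0 a c b e.
pose N0 := e * qform p`_2 p`_1 p`_0 b e - b * qform q`_2 q`_1 q`_0 b e.
pose D2 := a * qform q`_2 q`_1 q`_0 a c - c * qform p`_2 p`_1 p`_0 a c.
pose D1 := a * qpolar q`_2 q`_1 q`_0 a c b e - c * qpolar p`_2 p`_1 p`_0 a c b e.
pose D0 := a * qform q`_2 q`_1 q`_0 b e - c * qform p`_2 p`_1 p`_0 b e.
rewrite [X in v%:P * _ * X](_ : _ = D2%:P * 'X^2 + D1%:P * 'X + D0%:P); last first.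
  by rewrite /D2 /D1 /D0 /qform /qpolar; ring.
rewrite [X in 'X^2 * X](_ : _ = N2%:P * 'X^2 + N1%:P * 'X + N0%:P); last first.
  by rewrite /N2 /N1 /N0 /qform /qpolar; ring.
move=> h.
(* The equation reads v (X - 1) D = X^2 N: degrees 0 and 1 kill D0 and D1, and the higher degrees
   then determine N. *)
have {}h : (v * D2)%:P * 'X^3 + (v * (D1 - D2))%:P * 'X^2
    + (v * (D0 - D1))%:P * 'X + (- (v * D0))%:P
  = N2%:P * 'X^4 + N1%:P * 'X^3 + N0%:P * 'X^2.
  transitivity (v%:P * ('X - 1) * (D2%:P * 'X^2 + D1%:P * 'X + D0%:P)); first by ring.
  by rewrite h; ring.
have C i := congr1 (fun r : {poly F} => r`_i) h.
have := C 0; have := C 1; have := C 2; have := C 3; have := C 4.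
rewrite !(coefD, coefCM, coefXn, coefX, coefC) /= !(mulr0, mulr1, addr0, add0r).
move=> h4 h3 h2 /eqP h1 /eqP h0.
have D00 : D0 = 0 by apply/eqP; move: h0; rewrite oppr_eq0 mulf_eq0 (negPf v0).
have D10 : D1 = 0.
  by apply/eqP; move: h1; rewrite mulf_eq0 (negPf v0) D00 sub0r oppr_eq0.
exists D2; split; split => //; first by rewrite [D2 * v]mulrC.
by rewrite -/N0 -h2 D10 sub0r mulrN mulrC.
Qed.

Lemma moebius_proj a b c e x y : (x != 0) || (y != 0) ->
  moebius a b c e (proj_pt x y) = proj_pt (a * x + b * y) (c * x + e * y).
Proof.
move=> xy; have [k k0 [xE yE]] := proj_ptP xy.
rewrite /moebius; move: (proj_pt x y) xE yE => P -> ->.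
by rewrite !(mulrCA _ k) -!mulrDr proj_ptZ.
Qed.

Lemma linear_neq0 a b c e x y : a * e - b * c != 0 -> (x != 0) || (y != 0) ->
  (a * x + b * y != 0) || (c * x + e * y != 0).
Proof.
move=> det; apply: contraTT; rewrite !negb_or !negbK => /andP [/eqP h1 /eqP h2].
have hx : (a * e - b * c) * x = 0.
  by transitivity (e * (a * x + b * y) - b * (c * x + e * y)); [ring | rewrite h1 h2; ring].
have hy : (a * e - b * c) * y = 0.
  by transitivity (a * (c * x + e * y) - c * (a * x + b * y)); [ring | rewrite h1 h2; ring].
by move/eqP: hx; move/eqP: hy; rewrite !mulf_eq0 (negPf det) /= => -> ->.
Qed.

Lemma moebiusK a b c e P : a * e - b * c != 0 ->
  moebius e (- b) (- c) a (moebius a b c e P) = P.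
Proof.
move=> det; rewrite {2}/moebius moebius_proj ?linear_neq0 ?pt_neq0 //.
rewrite -[RHS](proj_ptK P) -[RHS](proj_ptZ (k := a * e - b * c)) //.
by congr proj_pt; ring.
Qed.

Lemma moebiusVK a b c e P : a * e - b * c != 0 ->
  moebius a b c e (moebius e (- b) (- c) a P) = P.
Proof.
move=> det; rewrite -{1}(opprK b) -{1}(opprK c); apply: moebiusK.
by rewrite mulrNN mulrC.
Qed.

Lemma rdeg_normal (v : F) : v != 0 -> rdeg (phi_normal v) = 2%N.
Proof.
by move=> v0; rewrite /rdeg /= size_polyXn size_scale // size_XsubC.
Qed.

Lemma rf_eval_normal (v : F) P : v != 0 -> rf_eval (phi_normal v) P =
  proj_pt (v * ((ptx P - pty P) * pty P)) (ptx P ^+ 2).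
Proof.
move=> v0; rewrite -{1}[P]proj_ptK rf_eval_proj ?rdeg_normal ?pt_neq0 //.
rewrite /numh /denh /phi_normal /qform /= !coefZ !coefB !coefXn !coefX !coef1 /=.
by congr proj_pt; ring.
Qed.

Lemma rf_eval_conj phi v a b c e P : is_rfun phi -> rdeg phi = 2%N -> v != 0 ->
  lin_conj_by phi (phi_normal v) a b c e ->
  rf_eval phi (moebius a b c e P) = moebius a b c e (rf_eval (phi_normal v) P).
Proof.
move=> hphi d2 v0 hc; have [k cf] := linear_conj_coefs d2 v0 hc.
have det := proj1 hc.
rewrite {1}/moebius rf_eval_proj // ?linear_neq0 ?pt_neq0 //.
have [] := conj_forms cf (idfun : {rmorphism F -> F}) (ptx P) (pty P).
have := forms_neq0 hphi d2 (linear_neq0 det (pt_neq0 P)).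
rewrite /numh /denh /=; set U := qform _ _ _ _ _; set V := qform _ _ _ _ _.
move=> UV h1 h2.
(* Cramer's rule recovers U and V from the two known combinations; if k were 0 both would vanish,
   against [forms_neq0]. *)
have h3 : (a * e - b * c) * U = k * (a * (v * ((ptx P - pty P) * pty P)) + b * ptx P ^+ 2).
  transitivity (a * (e * U - b * V) + b * (a * V - c * U)); first by ring.
  by rewrite h1 h2; ring.
have h4 : (a * e - b * c) * V = k * (c * (v * ((ptx P - pty P) * pty P)) + e * ptx P ^+ 2).
  transitivity (c * (e * U - b * V) + e * (a * V - c * U)); first by ring.
  by rewrite h1 h2; ring.
have k0 : k != 0.
  apply: contraTneq UV => k0; move/eqP: h3; move/eqP: h4; rewrite k0 !mul0r !mulf_eq0.
  by rewrite (negPf det) /= => /eqP -> /eqP ->; rewrite eqxx.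
rewrite rf_eval_normal // moebius_proj; first by rewrite -(proj_ptZ _ _ det) h3 h4 proj_ptZ.
case: P {U V UV h1 h2 h3 h4} => [z|] /=; last by rewrite expr1n oner_eq0 orbT.
case: (eqVneq z 0) => [->|z0]; last by rewrite expf_neq0 ?orbT.
by rewrite sub0r mulr1 mulf_neq0 // oppr_eq0 oner_eq0.
Qed.

(** The columns of the matrix are phi(P) and P, so that sigma sends infinity to phi(P) and 0 to P.
    The outer coefficients vanish because phi exchanges the two points, the middle one of the
    denominator because P is critical; [n1] plays the same part for phi(P). *)
Lemma normal_coefs phi P : is_rfun phi -> rdeg phi = 2%N -> is_critical phi P ->
  is_periodic (rf_eval phi) 2 P ->
  let Q := rf_eval phi P in
  let a := ptx Q in let c := pty Q in let b := ptx P in let e := pty P in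
  a * e - b * c != 0 /\
  exists n1 n0 d, [/\ conj_coefs phi a b c e n1 n0 d, n0 != 0, d != 0 &
    is_critical phi Q -> n1 = 0].
Proof.
move=> hphi d2 cP [_ [PP Pm]] Q a c b e.
have neqPQ : Q <> P by apply: (Pm 1%N).
have det : a * e - b * c != 0.
  apply/eqP; move: neqPQ; rewrite /a /b /c /e; case: (Q) (P) => [x|] [y|] //=.
  - by rewrite !mulr1 => nxy /eqP; rewrite subr_eq0 => /eqP xy; apply: nxy; rewrite xy.
  - by move=> _ /eqP; rewrite mulr0 mulr1 sub0r oppr_eq0 oner_eq0.
  - by move=> _ /eqP; rewrite mulr0 mulr1 subr0 oner_eq0.
split=> //.
have [k k0 [U0 V0]] := rf_evalP P hphi d2.
have [l l0 [U2 V2]] := rf_evalP Q hphi d2.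
have QP : rf_eval phi Q = P by [].
rewrite QP in U2 V2.
rewrite -/Q -/a -/b -/c -/e /numh /denh in U0 V0 U2 V2.
(* When one combines the two mixed coefficients with the value of phi at (x, y), a determinant times
   the Jacobian form comes out, and this is 0 at a critical point. *)
have jac (x y z t : F) :
  let p2 := phi.1`_2 in let p1 := phi.1`_1 in let p0 := phi.1`_0 in
  let q2 := phi.2`_2 in let q1 := phi.2`_1 in let q0 := phi.2`_0 in
  qform p2 p1 p0 x y * qpolar q2 q1 q0 x y z t
   - qform q2 q1 q0 x y * qpolar p2 p1 p0 x y z t =
  (x * t - z * y) * qform (p2 * q1 - p1 * q2) ((p2 * q0 - p0 * q2) *+ 2)
        (p1 * q0 - p0 * q1) x y.
  by rewrite /qform /qpolar /=; ring.
have polC (p2 p1 p0 : F) x y z t : qpolar p2 p1 p0 x y z t = qpolar p2 p1 p0 z t x y.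
  by rewrite /qpolar; ring.
exists (e * qpolar phi.1`_2 phi.1`_1 phi.1`_0 a c b e - b * qpolar phi.2`_2 phi.2`_1 phi.2`_0 a c b e).
exists (k * (a * e - b * c)), (l * (a * e - b * c)); split.
- split; split => //.
  + by rewrite U2 V2; ring.
  + by rewrite U0 V0; ring.
  + by rewrite U2 V2; ring.
  + apply: (mulfI k0); rewrite mulr0 mulrBr !mulrA -U0 -V0 !(polC _ _ _ a) jac.
    by rewrite critical_jacobian // mulr0.
  + by rewrite U0 V0; ring.
- exact: mulf_neq0.
- exact: mulf_neq0.
move=> cQ; apply: (mulfI l0); apply/eqP; rewrite mulr0 mulrBr !mulrA.
rewrite -oppr_eq0 opprB [l * e]mulrC [l * b]mulrC.
by rewrite [e * l]mulrC [b * l]mulrC -U2 -V2 jac critical_jacobian // mulr0.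
Qed.

End NormalForm.

(** * Rationality of numbers fixed by every automorphism of [algC] *)

Lemma num_field_separable (L : fieldExtType rat) (K E : {subfield L}) :
  separable K E.
Proof.
apply/separableP => y _; apply: contraT => /separablePn_pchar [p].
by rewrite pchar_lalg pchar_num.
Qed.

(** The number field generated by all roots of the minimal polynomial of x is normal over Q, and
    each of its automorphisms extends to [algC]. Hence x is fixed by its whole Galois group. *)
Lemma rat_of_aut_fixed (x : algC) :
  (forall nu : {rmorphism algC -> algC}, nu x = x) -> exists r : rat, x = ratr r.
Proof.
move=> fixx; have [p [Dp mon_p] _] := minCpolyP x.
have [rs Drs] := closed_field_poly_normal (minCpoly x).
rewrite (monicP (minCpoly_monic x)) scale1r in Drs.
have [Qs [QsC [s1 Ds1 gen]]] := num_field_exists rs.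
have ax : SplittingField.axiom Qs.
  exists (map_poly (in_alg Qs) p).
    by apply/polyOverP => i; rewrite coef_map /= memvZ // mem1v.
  exists s1 => //.
  suff -> : map_poly (in_alg Qs) p = \prod_(z <- s1) ('X - z%:P) by exact: eqpxx.
  apply: (map_poly_inj QsC); rewrite rmorph_prod /=.
  transitivity (minCpoly x).
    rewrite Dp -map_poly_comp; apply: eq_map_poly => a /=.
    by rewrite alg_num_field fmorph_rat.
  rewrite Drs -Ds1 big_map; apply: eq_bigr => z _.
  by rewrite rmorphB /= map_polyX map_polyC.
pose L : splittingFieldType rat :=
  HB.pack Qs (FieldExt_isSplittingField.Build rat Qs ax).
pose LC : {rmorphism L -> algC} := QsC.
have: x \in rs by rewrite -root_prod_XsubC -Drs root_minCpoly.
rewrite -Ds1 => /mapP [x1 _ xE].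
have gal1 : galois 1 {:L}.
  apply/and3P; split; [exact: sub1v | exact: num_field_separable | exact: normalFieldf].
have: (x1 : L) \in fixedField ('Gal({:L} / 1%AS))%g.
  apply/fixedFieldP; first exact: memvf.
  move=> s _; have [nu nuP] := extend_algC_subfield_aut QsC (s : {rmorphism L -> L}).
  by apply: (fmorph_inj LC); rewrite /= nuP -xE fixx.
move/galois_fixedField: gal1 => -> /vlineP [k x1E].
by exists k; rewrite xE x1E alg_num_field fmorph_rat.
Qed.

(** * Extension of the base field *)

Definition map_rfun (F F' : fieldType) (f : F -> F') (phi : rfun F) : rfun F' :=
  (map_poly f phi.1, map_poly f phi.2).

Section MapRfun.
Variables (F F' : fieldType) (f : {rmorphism F -> F'}).
Implicit Types (phi : rfun F) (P : option F).

Lemma rdeg_map phi : rdeg (map_rfun f phi) = rdeg phi.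
Proof. by rewrite /rdeg /= !size_map_poly. Qed.

Lemma is_rfun_map phi : is_rfun (map_rfun f phi) = is_rfun phi.
Proof. by rewrite /is_rfun /= coprimep_map map_poly_eq0. Qed.

Lemma rf_eval_map phi P :
  rf_eval (map_rfun f phi) (omap f P) = omap f (rf_eval phi P).
Proof.
case: P => [a|] /=; rewrite ?rdeg_map ?horner_map ?coef_map fmorph_eq0;
  by case: ifP => _ //=; rewrite ?horner_map ?coef_map fmorph_div.
Qed.

Lemma wr_map (u v : {poly F}) : wr (map_poly f u) (map_poly f v) = map_poly f (wr u v).
Proof. by rewrite /wr rmorphB !rmorphM /= -!deriv_map. Qed.

Lemma revd_map d (u : {poly F}) : revd d (map_poly f u) = map_poly f (revd d u).
Proof.
by apply/polyP => i; rewrite coef_map /= [LHS]coef_poly [(revd d u)`_i]coef_poly; case: ifP => _; rewrite ?coef_map ?rmorph0.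
Qed.

Lemma is_critical_map phi P :
  is_critical (map_rfun f phi) (omap f P) <-> is_critical phi P.
Proof.
have E (g : {poly F}) (x : F) : (map_poly f g).[f x] = 0 <-> g.[x] = 0.
  by rewrite horner_map; split=> [/eqP|->]; rewrite ?rmorph0 // fmorph_eq0 => /eqP.
case: P => [a|] /=; rewrite ?rdeg_map ?revd_map !wr_map.
  by rewrite horner_map fmorph_eq0; case: ifP.
have E0 (g : {poly F}) : (map_poly f g).[0] = f g.[0] by rewrite -horner_map rmorph0.
have E1 (g : {poly F}) : (map_poly f g).[0] = 0 <-> g.[0] = 0 by rewrite -E rmorph0.
by rewrite E0 fmorph_eq0; case: ifP => _; exact: E1.
Qed.

Lemma iter_rf_eval_map phi n P :
  iter n (rf_eval (map_rfun f phi)) (omap f P) = omap f (iter n (rf_eval phi) P).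
Proof. by elim: n => //= n ->; rewrite rf_eval_map. Qed.

Lemma is_periodic_map phi n P :
  is_periodic (rf_eval (map_rfun f phi)) n (omap f P) <-> is_periodic (rf_eval phi) n P.
Proof.
have inj : injective (omap f) by move=> [x|] [y|] //= [/fmorph_inj ->].
rewrite /is_periodic iter_rf_eval_map.
split=> -[n0 [h1 h2]]; split=> //; split.
- exact: inj.
- by move=> m hm e; apply: (h2 m hm); rewrite iter_rf_eval_map e.
- by rewrite h1.
- by move=> m hm; rewrite iter_rf_eval_map => /inj; apply: h2.
Qed.

Lemma hom_comp_map d (p : {poly F}) a b c e :
  hom_comp d (map_poly f p) (f a) (f b) (f c) (f e) = map_poly f (hom_comp d p a b c e).
Proof.
rewrite /hom_comp rmorph_sum; apply: eq_bigr => i _.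
by rewrite -!mul_polyC !rmorphM !rmorphXn !rmorphD !rmorphM /= coef_map !map_polyC map_polyX.
Qed.

Lemma lin_conj_by_map phi psi a b c e : lin_conj_by phi psi a b c e ->
  lin_conj_by (map_rfun f phi) (map_rfun f psi) (f a) (f b) (f c) (f e).
Proof.
move=> [det h]; split; first by rewrite -!rmorphM -rmorphB fmorph_eq0.
rewrite /= rdeg_map !hom_comp_map -!mul_polyC -!map_polyC -!rmorphM -!rmorphB -!rmorphM.
by rewrite !mul_polyC h.
Qed.

Lemma map_phi_normal v : map_rfun f (phi_normal v) = phi_normal (f v).
Proof.
by rewrite /map_rfun /phi_normal /= map_polyXn map_polyZ rmorphB /= map_polyX rmorph1.
Qed.

End MapRfun.

Lemma period2_normal (F : fieldType) (v : F) P : v != 0 ->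
  is_periodic (rf_eval (phi_normal v)) 2 P -> P = Some 0 \/ P = None.
Proof.
move=> v0; have := fun P => rf_eval_normal P v0.
move: (rf_eval _) => f fE [_ [/= h h1]]; case: P h h1 => [x|]; last by right.
case: (eqVneq x 0) => [->|x0]; first by left.
have x2 : (x ^+ 2 == 0) = false by rewrite expf_eq0 /= (negPf x0).
pose y := v * ((x - 1) * 1) / x ^+ 2.
have fx : f (Some x) = Some y by rewrite fE /proj_pt /= x2.
rewrite fx fE /proj_pt /=; case: ifP => // /negbT y2 [yx] h1.
have xy : x <> y by move=> e; apply: (h1 1%N isT); rewrite /= fx -e.
have E1 : y * x ^+ 2 = v * (x - 1) by rewrite /y divfK ?x2 // mulr1.
have E2 : x * y ^+ 2 = v * (y - 1) by rewrite -{1}yx divfK // mulr1.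
(* Subtracting the two equations gives x y = v, and then the second one v = 0. *)
have E3 : (x - y) * (x * y - v) = 0.
  transitivity (y * x ^+ 2 - x * y ^+ 2 - v * (x - y)); first by ring.
  by rewrite E1 E2; ring.
have E4 : x * y = v.
  move/eqP: E3; rewrite mulf_eq0 !subr_eq0 => /orP [/eqP //|/eqP //].
have: v = 0.
  transitivity (v * y - x * y ^+ 2); first by rewrite E2; ring.
  by rewrite -E4; ring.
by move/eqP; rewrite (negPf v0).
Qed.

(* If n1 = 0 the normal form n0 / (d x ^ 2) commutes with multiplication by a
   cube root of unity. *)
Lemma nontrivial_aut (phi : rfun algC) a b c e n0 d : rdeg phi = 2%N ->
  a * e - b * c != 0 -> conj_coefs phi a b c e 0 n0 d -> ~ aut_trivial phi.
Proof.
move=> d2 det cf.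
have [z z3] : exists z : algC, 3.-primitive_root z.
  by have [z] := @C_prim_root_exists 3 isT; exists z.
have zE : z ^+ 3 = 1 by apply: prim_expr_order.
have z1 : z != 1 by rewrite -[z]expr1 -(prim_order_dvd z3).
have /andP [s1 s2] := rdeg2_size d2.
(* The matrix M diag(z, 1) adj(M), where M has rows (a, b) and (c, e): the map x -> z x carried back
   through sigma. *)
pose a' := a * z * e - b * c; pose b' := a * b - a * z * b.
pose c' := c * z * e - e * c; pose e' := e * a - c * z * b.
move=> /(_ a' b' c' e') []; last first.
  move=> b0 [c0 ae].
  have z1' : 1 - z != 0 by rewrite subr_eq0 eq_sym.
  have ab0 : a * b = 0 by apply: (mulIf z1'); rewrite mul0r -b0 /b'; ring.
  have ce0 : c * e = 0 by apply: (mulIf z1'); rewrite mul0r -[RHS]oppr0 -c0 /c'; ring.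
  have s0 : a * e + b * c = 0.
    apply: (mulIf z1'); rewrite mul0r -(subrr e') -{2}ae /a' /e'; ring.
  move/eqP: det; apply; apply/eqP; rewrite -[_ == 0](expf_eq0 _ 2) /=.
  have -> : (a * e - b * c) ^+ 2 = (a * e + b * c) ^+ 2 - 4%:R * ((a * b) * (c * e)) by ring.
  by rewrite s0 ab0; apply/eqP; ring.
split.
  have -> : a' * e' - b' * c' = z * (a * e - b * c) ^+ 2.
    by rewrite /a' /b' /c' /e'; ring.
  by rewrite mulf_neq0 ?expf_neq0 // (prim_root_eq0 z3).
rewrite /= d2 !hom_comp2 -!mul_polyC.
(* (s, t) = adj(M) (X, 1). Hence M (s, t) is the determinant times (X, 1), and M (z s, t) is the
   candidate automorphism at (X, 1); comparing [conj_forms] at these two pairs uses only z ^ 3 =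
   1. *)
pose s : {poly algC} := e%:P * 'X - b%:P; pose t : {poly algC} := a%:P - c%:P * 'X.
have := conj_forms cf (polyC : {rmorphism algC -> {poly algC}}) s t.
have := conj_forms cf (polyC : {rmorphism algC -> {poly algC}}) (z%:P * s) t.
rewrite /=.
have -> : a%:P * (z%:P * s) + b%:P * t = a'%:P * 'X + b'%:P * 1.
  by rewrite /s /t /a' /b'; ring.
have -> : c%:P * (z%:P * s) + e%:P * t = c'%:P * 'X + e'%:P * 1.
  by rewrite /s /t /c' /e'; ring.
set U := qform _ _ _ (a'%:P * 'X + _) _; set V := qform _ _ _ (a'%:P * 'X + _) _.
pose D := (a * e - b * c)%:P : {poly algC}.
have -> : a%:P * s + b%:P * t = D * 'X by rewrite /s /t /D; ring.
have -> : c%:P * s + e%:P * t = D * 1 by rewrite /s /t /D; ring.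
rewrite !qformZ.
have pE (p : {poly algC}) : (size p <= 3)%N ->
    qform (p`_2)%:P (p`_1)%:P (p`_0)%:P 'X 1 = p.
  by move=> /poly_deg2 sp; rewrite [RHS]sp /qform -!mul_polyC; ring.
rewrite !pE // => -[h1 h2] [h3 h4].
have zP : z%:P ^+ 3 = 1 :> {poly algC} by rewrite -rmorphXn /= zE.
have D3 : D ^+ 3 != 0 by rewrite expf_neq0 // polyC_eq0.
have hN : e'%:P * U - b'%:P * V = D ^+ 3 * phi.1.
  transitivity (a%:P * (e%:P * U - b%:P * V) + b%:P * z%:P * (a%:P * V - c%:P * U)).
    by rewrite /e' /b'; ring.
  rewrite h1 h2.
  transitivity (a%:P * (e%:P * (D ^+ 2 * phi.1) - b%:P * (D ^+ 2 * phi.2))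
     + b%:P * (a%:P * (D ^+ 2 * phi.2) - c%:P * (D ^+ 2 * phi.1))).
    rewrite h3 h4; transitivity (a%:P * (n0%:P * t ^+ 2) + b%:P * d%:P * s ^+ 2 * z%:P ^+ 3).
      by rewrite polyC0; ring.
    by rewrite zP polyC0; ring.
  by rewrite /D; ring.
have hD : a'%:P * V - c'%:P * U = D ^+ 3 * phi.2.
  transitivity (c%:P * (e%:P * U - b%:P * V) + e%:P * z%:P * (a%:P * V - c%:P * U)).
    by rewrite /a' /c'; ring.
  rewrite h1 h2.
  transitivity (c%:P * (e%:P * (D ^+ 2 * phi.1) - b%:P * (D ^+ 2 * phi.2))
     + e%:P * (a%:P * (D ^+ 2 * phi.2) - c%:P * (D ^+ 2 * phi.1))).
    rewrite h3 h4; transitivity (c%:P * (n0%:P * t ^+ 2) + e%:P * d%:P * s ^+ 2 * z%:P ^+ 3).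
      by rewrite polyC0; ring.
    by rewrite zP polyC0; ring.
  by rewrite /D; ring.
by rewrite hN hD; ring.
Qed.

Lemma is_periodic_conj (T : eqType) (f g mu : T -> T) n x : injective mu ->
  (forall y, f (mu y) = mu (g y)) -> is_periodic f n (mu x) <-> is_periodic g n x.
Proof.
move=> inj h; have it k : iter k f (mu x) = mu (iter k g x).
  by elim: k => //= k ->.
rewrite /is_periodic it; split=> -[n0 [h1 h2]]; split=> //; split.
- exact: inj.
- by move=> m hm e; apply: (h2 m hm); rewrite it e.
- by rewrite h1.
- by move=> m hm; rewrite it => /inj; apply: h2.
Qed.

Lemma conj_coefs_map (F F' : fieldType) (f : {rmorphism F -> F'}) phi a b c e n1 n0 d :
  conj_coefs phi a b c e n1 n0 d ->
  conj_coefs (map_rfun f phi) (f a) (f b) (f c) (f e) (f n1) (f n0) (f d).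
Proof.
have E2 p2 p1 p0 x y : qform (f p2) (f p1) (f p0) (f x) (f y) = f (qform p2 p1 p0 x y).
  by rewrite /qform; ring.
have E1 p2 p1 p0 x y z t : qpolar (f p2) (f p1) (f p0) (f x) (f y) (f z) (f t)
    = f (qpolar p2 p1 p0 x y z t).
  by rewrite /qpolar; ring.
move=> [[e2 e1 e0] [g2 g1 g0]]; rewrite -e1 -e0 -g2.
by split; split; rewrite /= !coef_map /= ?E2 ?E1 -!rmorphM -rmorphB //= ?e2 ?g1 ?g0 rmorph0.
Qed.

Lemma moebius_inj (F : fieldType) (a b c e : F) : a * e - b * c != 0 ->
  injective (moebius a b c e).
Proof. by move=> det; apply: can_inj => P; apply: moebiusK. Qed.

(** * Existence of the normal form over Q *)

Section Existence.
Variable phi : rfun rat.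
Hypotheses (hphi : is_rfun phi) (d2 : rdeg phi = 2%N) (triv : aut_trivial (ratC phi)).

Let ratC_map : ratC phi = map_rfun (ratr : rat -> algC) phi. Proof. by []. Qed.
Let rC : {rmorphism rat -> algC} := ratr.

(** The field is left free because the lemma is applied twice: over [algC], to prove that P is
    rational, and then over Q. *)
Lemma normal_form_over (F : fieldType) (f : {rmorphism F -> algC}) (psi : rfun F) P :
  map_rfun f psi = ratC phi -> is_critical psi P -> is_periodic (rf_eval psi) 2 P ->
  exists v a b c e, [/\ v != 0, lin_conj_by psi (phi_normal v) a b c e,
    moebius a b c e (Some 0) = P &
    is_critical psi (moebius a b c e None) -> False].
Proof.
move=> psiE cP pP.
have hpsi : is_rfun psi by rewrite -(is_rfun_map f) psiE ratC_map (is_rfun_map rC).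
have dpsi : rdeg psi = 2%N by rewrite -(rdeg_map f) psiE ratC_map (rdeg_map rC).
have [det [n1 [n0 [d [cf n00 d0 cQ]]]]] := normal_coefs hpsi dpsi cP pP.
set Q := rf_eval psi P in det cf cQ.
have n10 : n1 != 0.
  apply/eqP => n10; rewrite n10 in cf.
  move: (conj_coefs_map f cf); rewrite psiE rmorph0 => cf'.
  apply: nontrivial_aut cf' triv; first by rewrite ratC_map (rdeg_map rC).
  by rewrite -!rmorphM -rmorphB fmorph_eq0.
pose k := - n0 / n1.
have k0 : k != 0 by rewrite mulf_neq0 ?oppr_eq0 ?invr_eq0.
have det' : k * ptx Q * pty P - ptx P * (k * pty Q) != 0.
  have -> : k * ptx Q * pty P - ptx P * (k * pty Q) = k * (ptx Q * pty P - ptx P * pty Q) by ring.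
  exact: mulf_neq0.
have kn : k * n1 = - n0 by rewrite /k divfK.
exists (k * n1 / (k ^+ 3 * d)), (k * ptx Q), (ptx P), (k * pty Q), (pty P).
have dk : k ^+ 3 * d != 0 by rewrite mulf_neq0 ?expf_neq0.
split.
- by rewrite kn mulf_neq0 ?invr_eq0 // oppr_eq0.
- exact: conj_coefs_linear (conj_coefs_scale k cf) dk kn.
- by rewrite /moebius /= !mulr0 !add0r !mulr1 proj_ptK.
rewrite /moebius /= !mulr0 !addr0 !mulr1 proj_ptZ // proj_ptK => /cQ /eqP.
by rewrite (negPf n10).
Qed.

Lemma critical_period2_rat P : is_critical (ratC phi) P ->
  is_periodic (rf_eval (ratC phi)) 2 P -> exists P0, P = omap rC P0.
Proof.
move=> cP pP.
have mapid : map_rfun (idfun : {rmorphism algC -> algC}) (ratC phi) = ratC phi.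
  by rewrite /map_rfun !map_poly_id //; case: (ratC phi).
have [v [a [b [c [e [v0 lc m0 mQ]]]]]] := normal_form_over mapid cP pP.
have det := proj1 lc.
have hpsi : is_rfun (ratC phi) by rewrite ratC_map (is_rfun_map rC).
have dpsi : rdeg (ratC phi) = 2%N by rewrite ratC_map (rdeg_map rC).
have fixP (nu : {rmorphism algC -> algC}) : omap nu P = P.
  have nuE : map_rfun nu (ratC phi) = ratC phi.
    by rewrite /map_rfun /= -!map_poly_comp; congr (_, _); apply: eq_map_poly => x /=;
       rewrite fmorph_rat.
  have: is_periodic (rf_eval (ratC phi)) 2 (omap nu P).
    by rewrite -nuE; apply: (is_periodic_map nu _ _ _).2.
  rewrite -(moebiusVK (omap nu P) det).
  rewrite (is_periodic_conj _ _ (moebius_inj det) (fun R => rf_eval_conj R hpsi dpsi v0 lc)).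
  case/(period2_normal v0) => E.
    by rewrite E m0.
  case: mQ; rewrite -E moebiusVK // -nuE; exact: (is_critical_map nu _ _).2.
case: P {cP pP m0} fixP => [x|] fixP; last by exists None.
have [nu|r ->] := rat_of_aut_fixed (x := x); last by exists (Some r).
by have [] := fixP nu.
Qed.

Lemma Qconj_phi_v_exists :
  (exists P : option algC,
      is_critical (ratC phi) P /\ is_periodic (rf_eval (ratC phi)) 2 P) ->
  exists2 v : rat, v != 0 & Qconj phi (phi_v v).
Proof.
move=> [P [cP pP]]; have [P0 PE] := critical_period2_rat cP pP.
move: cP pP; rewrite PE ratC_map => /(is_critical_map rC) cP /(is_periodic_map rC) pP.
have [v [a [b [c [e [v0 lc _ _]]]]]] := normal_form_over (f := rC) erefl cP pP.
by exists v => //; exists a, b, c, e.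
Qed.

End Existence.

(** * The field of 3-periodic points *)

Section Transport.
Variables (L : splittingFieldType rat) (emb : {rmorphism L -> algC}).
Implicit Types (E K : {subfield L}) (P : option algC).

(** The value [True] at infinity encodes Q(oo) = Q. *)
Definition pt_in E P : Prop := if P is Some z then exists2 x, x \in E & emb x = z else True.

Lemma moebius_pt_in E (a b c e : rat) P : pt_in E P ->
  pt_in E (moebius (ratr a) (ratr b) (ratr c) (ratr e) P).
Proof.
move=> hP; have [x [y [Ex Ey xE yE]]] :
    exists x y, [/\ x \in E, y \in E, emb x = ptx P & emb y = pty P].
  case: P hP => [z [x Ex xE] | _].
    by exists x, 1; split; rewrite ?mem1v ?rmorph1.
  by exists 1, 0; split; rewrite ?mem1v ?mem0v ?rmorph1 ?rmorph0.
have Er (r : rat) : ratr r \in E by rewrite -alg_num_field memvZ ?mem1v.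
rewrite /moebius /proj_pt -xE -yE -!(fmorph_rat emb) -!rmorphM -!rmorphD.
case: ifP => // _; rewrite -fmorph_div.
eexists; last by reflexivity.
by apply: rpredM; rewrite ?rpredV; apply: rpredD; apply: rpredM.
Qed.

(** A conjugation with rational coefficients matches the 3-periodic points of the two maps, and both
    it and its inverse keep coordinates inside any given subfield. *)
Lemma is_Q3field_conj (phi : rfun rat) (v : rat) K : is_rfun phi -> rdeg phi = 2%N ->
  v != 0 -> Qconj phi (phi_v v) -> is_Q3field phi emb K -> is_Q3field (phi_v v) emb K.
Proof.
move=> hphi d2 v0 [a [b [c [e lc]]]] [h1 h2].
pose rC : {rmorphism rat -> algC} := ratr.
have lcC : lin_conj_by (ratC phi) (phi_normal (rC v)) (rC a) (rC b) (rC c) (rC e).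
  by rewrite -(map_phi_normal rC); apply: lin_conj_by_map.
have psiE : ratC (phi_v v) = phi_normal (rC v) by rewrite -(map_phi_normal rC).
have det := proj1 lcC.
have rv0 : rC v != 0 by rewrite fmorph_eq0.
have hpsi : is_rfun (ratC phi) by rewrite (is_rfun_map rC).
have dpsi : rdeg (ratC phi) = 2%N by rewrite (rdeg_map rC).
have per P := is_periodic_conj 3 P (moebius_inj det)
  (fun R => rf_eval_conj R hpsi dpsi rv0 lcC).
have inv E P : pt_in E (moebius (rC a) (rC b) (rC c) (rC e) P) -> pt_in E P.
  rewrite -{2}(moebiusK P det) -!rmorphN; exact: moebius_pt_in.
rewrite /is_Q3field psiE; split.
  move=> z /per hz; apply: (inv K (Some z)).
  by case: moebius hz => // z' /h1.
move=> E hE; apply: h2 => z hz; apply: (_ : pt_in E (Some z)).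
move: hz; rewrite -(moebiusVK (Some z) det) => /per hz; apply: moebius_pt_in.
by case: moebius hz => // z' /hE.
Qed.

End Transport.

(** * The points of period 3 of [phi_normal v] *)

Section Period3.
Variables (F : numFieldType) (v w : F).
Hypotheses (v0 : v != 0) (w1 : w ^+ 2 + w + 1 = 0).

(* In the coordinate u = 1 - (1 - w) / x, the map phi_normal v restricted to the roots of
   u ^ 3 = per3_alpha is multiplication by w. *)
Definition per3_alpha : F := 1 - 3 * (1 - w) / v.
Definition per3_pt (u : F) : F := (1 - w) / (1 - u).

Let w2E : w ^+ 2 = - w - 1.
Proof. by apply/eqP; rewrite -subr_eq0 -w1; apply/eqP; ring. Qed.

Lemma cube_root1_neq1 : 1 - w != 0.
Proof.
apply/eqP => /eqP; rewrite subr_eq0 => /eqP w1E.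
have: (3 : F) = 0 by rewrite -[RHS]w1 -w1E; ring.
by move/eqP; rewrite pnatr_eq0.
Qed.

Lemma cube_roots_eq (a u : F) : u ^+ 3 = a ^+ 3 -> [\/ u = a, u = w * a | u = w ^+ 2 * a].
Proof.
move=> h; have: (u - a) * ((u - w * a) * (u - w ^+ 2 * a)) = 0.
  transitivity (u ^+ 3 - a ^+ 3); last by rewrite h subrr.
  by ring: w2E.
move/eqP; rewrite !mulf_eq0 !subr_eq0 => /or3P [] /eqP ->;
  [exact: Or31 | exact: Or32 | exact: Or33].
Qed.

Lemma per3_alpha_neq1 u : u ^+ 3 = per3_alpha -> 1 - u != 0.
Proof.
move=> h; apply/eqP => /eqP; rewrite subr_eq0 => /eqP u1.
move/eqP: h; rewrite -u1 expr1n -subr_eq0 /per3_alpha opprB addrC subrK mulf_eq0 invr_eq0.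
by rewrite (negPf v0) mulf_eq0 pnatr_eq0 (negPf cube_root1_neq1).
Qed.

Lemma per3_alpha_rot u : u ^+ 3 = per3_alpha -> (w * u) ^+ 3 = per3_alpha.
Proof.
by move=> <-; ring: w2E.
Qed.

Lemma rf_eval_per3_pt u : u ^+ 3 = per3_alpha ->
  rf_eval (phi_normal v) (Some (per3_pt u)) = Some (per3_pt (w * u)).
Proof.
move=> h; have u1 := per3_alpha_neq1 h; have wu1 := per3_alpha_neq1 (per3_alpha_rot h).
have x0 : per3_pt u != 0 by rewrite mulf_neq0 ?invr_eq0 ?cube_root1_neq1.
rewrite rf_eval_normal //= /proj_pt expf_eq0 /= (negPf x0) mulr1; congr Some.
(* The three factors vanish at the cube roots of unity, so their product is w (u^3 - 1), which is
   known from u^3 = alpha; the constant comes from (1 - w)^2 = - 3 w. *)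
have key : v * ((u - w) * (1 - u) * (1 - w * u)) = (1 - w) ^+ 3.
  transitivity (v * w * (u ^+ 3 - 1)); first by ring: w2E.
  rewrite h /per3_alpha; transitivity (- (3 * w * (1 - w))); first by field.
  by ring: w2E.
have xE : per3_pt u - 1 = (u - w) / (1 - u) by rewrite /per3_pt; field.
rewrite xE /per3_pt; apply: (mulIf wu1); rewrite divfK //.
transitivity (v * ((u - w) * (1 - u) * (1 - w * u)) / (1 - w) ^+ 2).
  by field; rewrite u1 cube_root1_neq1.
by rewrite key; field; exact: cube_root1_neq1.
Qed.

Lemma per3_pt_inj u u' : 1 - u != 0 -> 1 - u' != 0 -> per3_pt u = per3_pt u' -> u = u'.
Proof.
move=> u0 u0' /(mulfI cube_root1_neq1) /invr_inj h.
by rewrite -[u]opprK -[u'](opprK) -(addKr 1 (- u)) h addKr.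
Qed.

Lemma per3_pt_periodic u : per3_alpha != 0 -> u ^+ 3 = per3_alpha ->
  is_periodic (rf_eval (phi_normal v)) 3 (Some (per3_pt u)).
Proof.
move=> a0 h1; have h2 := per3_alpha_rot h1; have h3 := per3_alpha_rot h2.
have E1 := rf_eval_per3_pt h1; have E2 := rf_eval_per3_pt h2; have E3 := rf_eval_per3_pt h3.
have u0 : u != 0 by apply: contraNneq a0 => u0; rewrite -h1 u0 expr0n.
have n1 : u <> w * u.
  move=> e; have: (1 - w) * u = 0 by rewrite mulrBl mul1r -e subrr.
  by move/eqP; rewrite mulf_eq0 (negPf u0) (negPf cube_root1_neq1).
have n2 : u <> w * (w * u).
  move=> e; apply: n1.
  have h : w * (w * (w * u)) = u by ring: w2E.
  by rewrite -[LHS]h -e.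
move: (rf_eval _) E1 E2 E3 => f E1 E2 E3.
split=> //; rewrite /= E1 E2 E3; split; first by congr (Some (per3_pt _)); ring: w2E.
case=> [|[|[|m]]] //= _; rewrite E1 ?E2 => -[] /per3_pt_inj h.
  by apply: n1; rewrite h // per3_alpha_neq1.
by apply: n2; rewrite h // per3_alpha_neq1.
Qed.

End Period3.

Lemma period3_pts (F : numFieldType) (v w x : F) : v != 0 -> w ^+ 2 + w + 1 = 0 ->
  is_periodic (rf_eval (phi_normal v)) 3 (Some x) ->
  (exists2 u, u ^+ 3 = per3_alpha v w & x = per3_pt w u) \/
  (exists2 u, u ^+ 3 = per3_alpha v (w ^+ 2) & x = per3_pt (w ^+ 2) u).
Proof.
move=> v0 w1; have := fun P => rf_eval_normal P v0.
have w2E : w ^+ 2 = - w - 1 by apply/eqP; rewrite -subr_eq0 -w1; apply/eqP; ring.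
have w1' : (w ^+ 2) ^+ 2 + w ^+ 2 + 1 = 0 by ring: w2E.
have c3 : (3 : F) != 0 by rewrite pnatr_eq0.
move: (rf_eval _) => f fE [_ [/= h3 hm]].
have fS y : y != 0 -> f (Some y) = Some (v * (y - 1) / y ^+ 2).
  by move=> y0; rewrite fE /proj_pt /= expf_eq0 (negPf y0) mulr1.
have f0 : f (Some 0) = None by rewrite fE /proj_pt /= expr0n eqxx.
have fN : f None = Some 0 by rewrite fE /proj_pt /= subr0 mulr0 mulr0 expr1n oner_eq0 mul0r.
have x0 : x != 0 by apply/eqP => x0; move: h3; rewrite x0 f0 fN f0.
pose y := v * (x - 1) / x ^+ 2.
have fx : f (Some x) = Some y by rewrite fS.
have y0 : y != 0.
  by apply/eqP => y0; move: h3; rewrite fx y0 f0 fN => -[/esym/eqP]; rewrite (negPf x0).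
pose z := v * (y - 1) / y ^+ 2.
have fy : f (Some y) = Some z by rewrite fS.
have z0 : z != 0 by apply/eqP => z0; move: h3; rewrite fx fy z0 f0.
have fz : v * (z - 1) / z ^+ 2 = x by move: h3; rewrite fx fy fS // => -[].
have xy : x <> y by move=> e; apply: (hm 1%N isT); rewrite /= fx -e.
have E1 : y * x ^+ 2 = v * (x - 1) by rewrite divfK // expf_neq0.
have E2 : z * y ^+ 2 = v * (y - 1) by rewrite divfK // expf_neq0.
have E3 : x * z ^+ 2 = v * (z - 1) by rewrite -{1}fz divfK // expf_neq0.
(* A + w B is the cubic g_w, so A^2 - A B + B^2 is the dynatomic sextic, while x^3 - v x + v
   vanishes at the fixed points. Their product comes from eliminating z, then y, from the three
   equations of the cycle. *)
pose A := x ^+ 3 - v * x ^+ 2 + v * x; pose B := v * (1 - x).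
have key : (x ^+ 3 - v * x + v) * (A ^+ 2 - A * B + B ^+ 2) = 0.
  have G1 : y ^+ 2 * (v * (y - 1) - y ^+ 2) = x * v * (y - 1) ^+ 2.
    apply: (mulfI v0).
    transitivity (v * (z - 1) * y ^+ 4).
      transitivity (v * (y ^+ 2) * (z * y ^+ 2 - y ^+ 2)); first by rewrite E2; ring.
      by ring.
    rewrite -E3; transitivity (x * (z * y ^+ 2) ^+ 2); first by ring.
    by rewrite E2; ring.
  pose m := x ^+ 2 - v * x + v.
  have G2 : (y - 1) * x ^+ 2 = - m by rewrite mulrBl E1 /m; ring.
  apply: (mulfI v0); rewrite mulr0.
  transitivity (x * v * ((y - 1) * x ^+ 2) ^+ 2 * x ^+ 4
     - (y * x ^+ 2) ^+ 2 * (v * ((y - 1) * x ^+ 2) * x ^+ 2 - (y * x ^+ 2) ^+ 2)).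
    by rewrite G2 E1 /A /B /m; ring.
  transitivity (x ^+ 8 * (x * v * (y - 1) ^+ 2 - y ^+ 2 * (v * (y - 1) - y ^+ 2))).
    by ring.
  by rewrite G1 subrr mulr0.
have nfix : x ^+ 3 - v * x + v != 0.
  apply/eqP => h; apply: xy; apply: (mulIf (expf_neq0 2 x0)).
  by rewrite E1; apply/eqP; rewrite -subr_eq0 -h; apply/eqP; ring.
have {key} : (A + w * B) * (A + w ^+ 2 * B) = 0.
  transitivity (A ^+ 2 - A * B + B ^+ 2); first by ring: w2E.
  by move/eqP: key; rewrite mulf_eq0 (negPf nfix) => /eqP.
have fin w' : w' ^+ 2 + w' + 1 = 0 -> A + w' * B = 0 ->
    exists2 u, u ^+ 3 = per3_alpha v w' & x = per3_pt w' u.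
  move=> hw hAB; have hw2 : w' ^+ 2 = - w' - 1.
    by apply/eqP; rewrite -subr_eq0 -hw; apply/eqP; ring.
  have w'1 := cube_root1_neq1 hw.
  exists (1 - (1 - w') / x); last by rewrite /per3_pt subKr invf_div mulrC divfK.
  apply/eqP; rewrite -subr_eq0 /per3_alpha; apply/eqP.
  transitivity (3 * (1 - w') * (A + w' * B) / (v * x ^+ 3)); last by rewrite hAB mulr0 mul0r.
  apply: (mulIf (mulf_neq0 v0 (expf_neq0 3 x0))); rewrite divfK ?mulf_neq0 ?expf_neq0 //.
  transitivity (v * (x - (1 - w')) ^+ 3 - (v - 3 * (1 - w')) * x ^+ 3).
    by field; rewrite v0 x0.
  by rewrite /A /B; ring: hw2.
by move/eqP; rewrite mulf_eq0 => /orP [] /eqP /fin h; [left | right]; apply: h.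
Qed.

Lemma no_rat_cube_root1 (r : rat) : r ^+ 2 + r + 1 <> 0.
Proof. by move=> h; nra. Qed.

Lemma per3_alpha_ratr_neq0 (F : numFieldType) (v : rat) (w : F) : v != 0 ->
  w ^+ 2 + w + 1 = 0 -> per3_alpha (ratr v) w != 0.
Proof.
move=> v0 w1; have v0' : ratr v != 0 :> F by rewrite fmorph_eq0.
apply/eqP => h; apply: (@no_rat_cube_root1 (1 - v / 3)).
apply: (fmorph_inj (ratr : {rmorphism rat -> F})); rewrite rmorph0 -[RHS]w1.
have -> : w = ratr (1 - v / 3); last first.
  by move: (1 - v / 3) => r; rewrite !rmorphD rmorph1 rmorphXn.
rewrite rmorphB rmorph1 fmorph_div /= ratr_nat.
apply/eqP; rewrite -subr_eq0; apply/eqP; rewrite -[RHS](mulr0 (ratr v / 3)) -h /per3_alpha.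
by field; exact: v0'.
Qed.

Lemma Q3field_gens (v : rat) (L : splittingFieldType rat) (emb : {rmorphism L -> algC})
    (K : {subfield L}) : v != 0 -> is_Q3field (phi_v v) emb K ->
  exists W A B : L, [/\ W \in K, A \in K, B \in K &
    forall E : {subfield L}, W \in E -> A \in E -> B \in E -> (K <= E)%VS] /\
  [/\ W ^+ 2 + W + 1 = 0, A ^+ 3 = 1 - 3 * (1 - W) / ratr v &
      B ^+ 3 = 1 - 3 * (1 - W ^+ 2) / ratr v].
Proof.
move=> v0; pose rC : {rmorphism rat -> algC} := ratr; pose rv := rC v.
have psiE : ratC (phi_v v) = phi_normal rv by rewrite -(map_phi_normal rC).
rewrite /is_Q3field psiE => -[h1 h2].
have rv0 : rv != 0 by rewrite fmorph_eq0.
have [w w1] : exists w : algC, w ^+ 2 + w + 1 = 0.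
  have [w w3] := @C_prim_root_exists 3 isT; exists w.
  have wn1 : w - 1 != 0 by rewrite subr_eq0 -[w]expr1 -(prim_order_dvd w3).
  apply: (mulfI wn1); rewrite mulr0; transitivity (w ^+ 3 - 1); first by ring.
  by rewrite (prim_expr_order w3) subrr.
have w2E : w ^+ 2 = - w - 1 by apply/eqP; rewrite -subr_eq0 -w1; apply/eqP; ring.
have w1' : (w ^+ 2) ^+ 2 + w ^+ 2 + 1 = 0 by ring: w2E.
pose a := 3.-root (per3_alpha rv w); pose b := 3.-root (per3_alpha rv (w ^+ 2)).
have ha : a ^+ 3 = per3_alpha rv w by rewrite rootCK.
have hb : b ^+ 3 = per3_alpha rv (w ^+ 2) by rewrite rootCK.
have al0 := per3_alpha_ratr_neq0 v0 w1; have be0 := per3_alpha_ratr_neq0 v0 w1'.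
have hwa := per3_alpha_rot w1 ha.
have [X0 KX0 X0E] := h1 _ (per3_pt_periodic rv0 w1 al0 ha).
have [X1 KX1 X1E] := h1 _ (per3_pt_periodic rv0 w1 al0 hwa).
have [Y KY YE] := h1 _ (per3_pt_periodic rv0 w1' be0 hb).
have na := per3_alpha_neq1 rv0 w1 ha; have nwa := per3_alpha_neq1 rv0 w1 hwa.
have nb := per3_alpha_neq1 rv0 w1' hb.
have nw := cube_root1_neq1 w1; have nw2 := cube_root1_neq1 w1'.
(* With X0 = (1 - w) / (1 - u) and X1 = (1 - w) / (1 - w u), the difference X0 / X1 - X0 equals w.
   So two successive points of one cycle already yield the cube root of unity, and A and B are the
   u-coordinates of X0 and Y. *)
pose W := X0 / X1 - X0; pose A := 1 - (1 - W) / X0; pose B := 1 - (1 - W ^+ 2) / Y.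
have WE : emb W = w.
  rewrite rmorphB fmorph_div X0E X1E /per3_pt; field.
  by rewrite na nwa nw.
have AE : emb A = a.
  rewrite rmorphB rmorph1 fmorph_div rmorphB rmorph1 WE X0E /per3_pt.
  by rewrite invf_div mulrC divfK // subKr.
have BE : emb B = b.
  rewrite rmorphB rmorph1 fmorph_div rmorphB rmorphXn rmorph1 /= WE YE /per3_pt.
  by rewrite invf_div mulrC divfK // subKr.
have KW : W \in K by rewrite rpredB ?rpred_div.
have KA : A \in K by exact: rpredB (mem1v K) (rpred_div (rpredB (mem1v K) KW) KX0).
have KB : B \in K.
  exact: rpredB (mem1v K) (rpred_div (rpredB (mem1v K) (rpredX 2 KW)) KY).
clearbody B A W; exists W, A, B; split; split=> //.
- move=> E EW EA EB; apply: h2 => x /(period3_pts rv0 w1) [] [u hu ->].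
    have [U EU <-] : exists2 U, U \in E & emb U = u.
      case: (cube_roots_eq w1 (etrans hu (esym ha))) => ->.
      + by exists A.
      + by exists (W * A); rewrite ?rpredM // rmorphM WE AE.
      + by exists (W ^+ 2 * A); rewrite ?rpredM ?rpredX // rmorphM rmorphXn /= WE AE.
    exists ((1 - W) / (1 - U)); first exact: rpred_div (rpredB (mem1v E) EW) (rpredB (mem1v E) EU).
    by rewrite fmorph_div !rmorphB rmorph1 WE.
  have [U EU <-] : exists2 U, U \in E & emb U = u.
    case: (cube_roots_eq w1 (etrans hu (esym hb))) => ->.
    + by exists B.
    + by exists (W * B); rewrite ?rpredM // rmorphM WE BE.
    + by exists (W ^+ 2 * B); rewrite ?rpredM ?rpredX // rmorphM rmorphXn /= WE BE.
  exists ((1 - W ^+ 2) / (1 - U)); first exact: rpred_div (rpredB (mem1v E) (rpredX 2 EW)) (rpredB (mem1v E) EU).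
  by rewrite fmorph_div !rmorphB rmorph1 rmorphXn /= WE.
- by apply: (fmorph_inj emb); rewrite !rmorphD rmorphXn rmorph1 rmorph0 /= WE.
- apply: (fmorph_inj emb); rewrite rmorphXn /= AE ha /per3_alpha.
  by rewrite rmorphB rmorph1 fmorph_div rmorphM rmorphB rmorph1 WE rmorph_nat fmorph_rat.
- apply: (fmorph_inj emb); rewrite rmorphXn /= BE hb /per3_alpha.
  by rewrite rmorphB rmorph1 fmorph_div rmorphM rmorphB rmorph1 rmorphXn /= WE rmorph_nat fmorph_rat.
Qed.

(** * Fermat's last theorem for exponent 3 *)

(* The pair (a, b) stands for the Eisenstein integer a + b w, w ^ 2 + w + 1 = 0. *)
Definition eis : Type := (int * int)%type.
HB.instance Definition _ := GRing.Zmodule.copy eis (int * int)%type.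

Definition Eis (a b : int) : eis := (a, b).
Definition eis_mul (x y : eis) : eis :=
  Eis (x.1 * y.1 - x.2 * y.2) (x.1 * y.2 + x.2 * y.1 - x.2 * y.2).

Lemma eisP (x y : eis) : x.1 = y.1 -> x.2 = y.2 -> x = y.
Proof. by case: x y => a b [c d] /= -> ->. Qed.

Fact eis_mulA : associative eis_mul.
Proof. by move=> x y z; apply: eisP => /=; ring. Qed.
Fact eis_mulC : commutative eis_mul.
Proof. by move=> x y; apply: eisP => /=; ring. Qed.
Fact eis_mul1 : left_id (Eis 1 0) eis_mul.
Proof. by move=> x; apply: eisP => /=; ring. Qed.
Fact eis_mulDl : left_distributive eis_mul +%R.
Proof. by move=> x y z; apply: eisP; rewrite /=; ring. Qed.
Fact eis_one_neq0 : Eis 1 0 != 0. Proof. by []. Qed.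
HB.instance Definition _ :=
  GRing.Zmodule_isComNzRing.Build eis eis_mulA eis_mulC eis_mul1 eis_mulDl eis_one_neq0.

Definition eis_norm (x : eis) : int := x.1 ^+ 2 - x.1 * x.2 + x.2 ^+ 2.
Definition eis_conj (x : eis) : eis := Eis (x.1 - x.2) (- x.2).

Lemma eis_add1 (x y : eis) : (x + y).1 = x.1 + y.1. Proof. by []. Qed.
Lemma eis_add2 (x y : eis) : (x + y).2 = x.2 + y.2. Proof. by []. Qed.
Lemma eis_opp1 (x : eis) : (- x).1 = - x.1. Proof. by []. Qed.
Lemma eis_opp2 (x : eis) : (- x).2 = - x.2. Proof. by []. Qed.
Lemma eis_mul1E (x y : eis) : (x * y).1 = x.1 * y.1 - x.2 * y.2. Proof. by []. Qed.
Lemma eis_mul2E (x y : eis) : (x * y).2 = x.1 * y.2 + x.2 * y.1 - x.2 * y.2.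
Proof. by []. Qed.
Definition eisE := (eis_add1, eis_add2, eis_opp1, eis_opp2, eis_mul1E, eis_mul2E).

Lemma eis_normM x y : eis_norm (x * y) = eis_norm x * eis_norm y.
Proof. by rewrite /eis_norm !eisE; ring. Qed.

Lemma eis_mul_conj x : x * eis_conj x = Eis (eis_norm x) 0.
Proof. by apply: eisP; rewrite !eisE /eis_norm /=; ring. Qed.

Lemma eis_norm_ge0 x : 0 <= eis_norm x.
Proof. by rewrite /eis_norm; nia. Qed.

Lemma eis_norm_eq0 x : eis_norm x = 0 -> x = 0.
Proof. by rewrite /eis_norm => h; apply: eisP => /=; nia. Qed.

Lemma round_div (s n : int) : 0 < n -> exists q, - n <= 2 * (s - q * n) <= n.
Proof.
move=> n0; exists ((2 * s + n) %/ (2 * n))%Z.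
have := divz_eq (2 * s + n) (2 * n).
have := modz_ge0 (2 * s + n) (d := 2 * n); have := ltz_pmod (2 * s + n) (d := 2 * n).
move: (_ %/ _)%Z (_ %% _)%Z => q r; nia.
Qed.

(** Rounding both coordinates of x conj(y) / n to nearest integers leaves remainders s, t with |s|,
    |t| <= n / 2, and then s^2 - s t + t^2 <= 3 n^2 / 4 < n^2. *)
Lemma eis_euclid (x y : eis) : y != 0 -> exists q, eis_norm (x - q * y) < eis_norm y.
Proof.
move=> y0; set n := eis_norm y.
have n0 : 0 < n.
  rewrite lt0r eis_norm_ge0 andbT.
  by apply: contra_neq y0 => /eis_norm_eq0.
pose z := x * eis_conj y.
have [q1 hq1] := round_div z.1 n0; have [q2 hq2] := round_div z.2 n0.
exists (Eis q1 q2); rewrite -(ltr_pM2r n0) {1}/n.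
have -> : eis_norm y = eis_norm (eis_conj y) by rewrite /eis_norm /=; ring.
rewrite -eis_normM.
have -> : (x - Eis q1 q2 * y) * eis_conj y = Eis (z.1 - q1 * n) (z.2 - q2 * n).
  rewrite mulrBl -mulrA eis_mul_conj -/n -/z.
  by apply: eisP; rewrite !eisE /=; ring.
move: hq1 hq2; rewrite /eis_norm /=.
move: (z.1 - _) (z.2 - _) => s t; clear -n0; move=> *; nia.
Qed.

Lemma eis_bezout (x y : eis) : exists d u v p q,
  [/\ d = u * x + v * y, x = p * d & y = q * d].
Proof.
have [N] := ubnP `|eis_norm y|%N; elim: N x y => // N IH x y hN.
case: (eqVneq y 0) => [->|y0].
  by exists x, 1, 0, 1, 0; split; ring.
have [k hk] := eis_euclid x y0.
have [|d [u [v [p [q [h1 h2 h3]]]]]] := IH y (x - k * y).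
  by have := eis_norm_ge0 (x - k * y); move: hN hk; lia.
exists d, v, (u - v * k), (q + k * p), p; split => //.
  by rewrite h1; ring.
by rewrite -[LHS](subrK (k * y)) h3 h2; ring.
Qed.

(* With d = gcd(t, m), the ideal of d ^ 3 is t (t ^ 2, t m, m ^ 2, t'), hence that of t. *)
Lemma coprime_mul_cube (R : comNzRingType) (t t' m a b d u v p q : R) :
  t * t' = m ^+ 3 -> a * t + b * t' = 1 -> d = u * t + v * m -> t = p * d -> m = q * d ->
  exists k1 k2, d ^+ 3 = t * k1 /\ t = k2 * d ^+ 3.
Proof.
move=> tt' cop dE tE mE.
exists (u ^+ 3 * t ^+ 2 + 3 * u ^+ 2 * v * t * m + 3 * u * v ^+ 2 * m ^+ 2 + v ^+ 3 * t').
exists (a ^+ 2 * p ^+ 3 + (2 * a * b * t + b ^+ 2 * t') * q ^+ 3); split.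
  transitivity (u ^+ 3 * t ^+ 3 + 3 * u ^+ 2 * v * t ^+ 2 * m + 3 * u * v ^+ 2 * m ^+ 2 * t
     + v ^+ 3 * m ^+ 3); first by rewrite dE; ring.
  by rewrite -tt'; ring.
transitivity (a ^+ 2 * (p * d) ^+ 3 + (2 * a * b * t + b ^+ 2 * t') * (q * d) ^+ 3); last by ring.
rewrite -tE -mE -tt'; transitivity (t * (a * t + b * t') ^+ 2); last by ring.
by rewrite cop; ring.
Qed.

(** For a nonzero, a and gcd(a, c)^3 differ by a unit by [coprime_mul_cube], and the units 1 and -1
    are cubes. *)
Lemma int_coprime_cube (a b c : int) : coprimez a b -> a * b = c ^+ 3 -> exists r, a = r ^+ 3.
Proof.
move=> /coprimezP [[u v] /= uv] abc.
have [x [y dE]] := Bezoutz a c.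
have /dvdzP [p aE] := dvdz_gcdl a c; have /dvdzP [q cE] := dvdz_gcdr a c.
have [k1 [k2 [h1 h2]]] := coprime_mul_cube abc uv (esym dE) aE cE.
case: (eqVneq a 0) => [->|a0]; first by exists 0.
have k12 : k2 * k1 = 1 by apply: (mulfI a0); rewrite mulr1 {2}h2 h1; ring.
have : k2 = 1 \/ k2 = -1.
  have /eqP := congr1 absz k12; rewrite abszM muln_eq1 => /andP [/eqP h _]; lia.
case=> k2E; rewrite h2 k2E; first by exists (gcdz a c); rewrite mul1r.
by exists (- gcdz a c); ring.
Qed.

(** A unit has norm 1, and 4 N = (2 a - b)^2 + 3 b^2 leaves few pairs. The three cases are 1, w and
    1 + w = - w^2, each with its opposite. *)
Lemma eis_unit (x y : eis) : x * y = 1 ->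
  [\/ x = Eis 1 0 \/ x = Eis (-1) 0, x = Eis 0 1 \/ x = Eis 0 (-1) |
      x = Eis 1 1 \/ x = Eis (-1) (-1)].
Proof.
move=> xy; have nx := eis_norm_ge0 x; have ny := eis_norm_ge0 y.
have n1 : eis_norm x = 1.
  have /(congr1 absz)/eqP : eis_norm x * eis_norm y = 1 by rewrite -eis_normM xy.
  rewrite abszM muln_eq1 => /andP [/eqP h _]; lia.
case: x n1 {xy nx} => a b; rewrite /eis_norm /= => n1.
have hb : b = 0 \/ b = 1 \/ b = -1 by nia.
case: hb => [|[]] bE; subst b.
- have: a = 1 \/ a = -1 by nia.
  by case=> ->; apply: Or31; [left | right].
- have: a = 0 \/ a = 1 by nia.
  by case=> ->; [apply: Or32; left | apply: Or33; left].
- have: a = 0 \/ a = -1 by nia.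
  by case=> ->; [apply: Or32; right | apply: Or33; right].
Qed.

Lemma cube_mod9 (x : int) : ~~ (3 %| x)%Z ->
  exists k, x ^+ 3 = 9 * k + 1 \/ x ^+ 3 = 9 * k - 1.
Proof.
move=> nx; have [i [xE|xE]] : exists i, x = 3 * i + 1 \/ x = 3 * i - 1.
- exists ((x + 1) %/ 3)%Z; lia.
- by exists (3 * i ^+ 3 + 3 * i ^+ 2 + i); left; rewrite xE; ring.
- by exists (3 * i ^+ 3 - 3 * i ^+ 2 + i); right; rewrite xE; ring.
Qed.

Lemma cube_mod3 (x : int) : exists i, x ^+ 3 = x + 3 * i.
Proof.
have [i [xE|[xE|xE]]] : exists i, x = 3 * i \/ x = 3 * i + 1 \/ x = 3 * i - 1.
- exists ((x + 1) %/ 3)%Z; lia.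
- by exists (9 * i ^+ 3 - i); rewrite xE; ring.
- by exists (9 * i ^+ 3 + 9 * i ^+ 2 + 2 * i); rewrite xE; ring.
- by exists (9 * i ^+ 3 - 9 * i ^+ 2 + 2 * i); rewrite xE; ring.
Qed.

Lemma coprimez3 (x : int) : coprimez 3 x = ~~ (3 %| x)%Z.
Proof. by rewrite coprimezE prime_coprime. Qed.

Lemma eis_cube (x : eis) : x ^+ 3 =
  Eis (x.1 ^+ 3 + x.2 ^+ 3 - 3 * x.1 * x.2 ^+ 2) (3 * (x.1 * x.2 * (x.1 - x.2))).
Proof. by apply: eisP; rewrite !exprS expr0 mulr1 !eisE /=; ring. Qed.

(* x + y = 9 n ^ 3 and x ^ 2 - x y + y ^ 2 = 3 m ^ 3, so th = (x + y w) / (1 - w) has norm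
   m ^ 3 and is a cube (c + d w) ^ 3; comparing coordinates, n ^ 3 = c d (c - d). *)
Lemma fermat3_descent (x y z : int) : coprimez x y -> (3 %| z)%Z -> z != 0 ->
  x ^+ 3 + y ^+ 3 = z ^+ 3 -> exists r s t : int,
  [/\ coprimez s t, s ^+ 3 + t ^+ 3 = r ^+ 3, r * s * t != 0 & (absz (r * s * t)%R < absz z)%N].
Proof.
move=> cxy /dvdzP [z' zE] z0 fermat.
have z'0 : z' != 0 by apply: contra_neq z0 => z'0; rewrite zE z'0 mul0r.
have [k kE] : exists k, x + y = 3 * k.
  have [i iE] := cube_mod3 x; have [j jE] := cube_mod3 y.
  exists (9 * z' ^+ 3 - i - j); move: fermat; rewrite iE jE zE => h.
  transitivity (x + 3 * i + (y + 3 * j) - 3 * (i + j)); first by ring.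
  by rewrite h; ring.
have [[u v] /= uv] := coprimezP _ _ cxy.
have c3 (a b p q : int) : p * a + q * b = 1 -> a + b = 3 * k -> coprimez 3 a.
  move=> pq ab; rewrite coprimez3; apply/negP => /dvdzP [i aE].
  have: 3 * (p * i + q * (k - i)) = 1; last by lia.
  have bE : b = 3 * k - a by rewrite -ab; ring.
  by rewrite -[RHS]pq bE aE; ring.
have c3x : coprimez 3 x by apply: c3 uv kE.
have c3y : coprimez 3 y by apply: (c3 _ x v u); rewrite addrC.
have c3xy q : coprimez 3 (q * 3 - x * y).
  by rewrite /coprimez gcdzMDl gcdzN -/(coprimez _ _) coprimezMr c3x.
have yE : y = 3 * k - x by rewrite -kE; ring.
have E1 : 3 * z' ^+ 3 = k * (k ^+ 2 * 3 - x * y).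
  apply: (@mulfI _ (9 : int)) => //; transitivity (z ^+ 3); first by rewrite zE; ring.
  by rewrite -fermat yE; ring.
have /dvdzP [n' kE'] : (3 %| k)%Z.
  by rewrite -(Gauss_dvdzl k (c3xy (k ^+ 2))) -E1 dvdz_mulr.
have E2 : z' ^+ 3 = n' * (27 * n' ^+ 2 - x * y).
  by apply: (@mulfI _ (3 : int)) => //; rewrite E1 kE'; ring.
have cn : coprimez n' (27 * n' ^+ 2 - x * y).
  have -> : 27 * n' ^+ 2 - x * y = (27 * n') * n' + - (x * y) by ring.
  rewrite /coprimez gcdzMDl gcdzN -/(coprimez _ _) coprimezMr; apply/andP; split.
    apply/coprimezP; exists (9 * v, u - v) => /=.
    by rewrite -[RHS]uv yE kE'; ring.
  apply/coprimezP; exists (9 * u, v - u) => /=.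
  by rewrite -[RHS]uv yE kE'; ring.
have [n nE] := int_coprime_cube cn (esym E2).
have [m mE] : exists m, 27 * n' ^+ 2 - x * y = m ^+ 3.
  by apply: (@int_coprime_cube _ n' z'); rewrite 1?coprimez_sym // mulrC.
have c9 : coprimez (9 * n ^+ 3) (m ^+ 3).
  rewrite -nE -mE coprimezMl cn andbT (_ : 9 = 3 ^+ 2) // coprimezXl //.
  by rewrite (_ : 27 * n' ^+ 2 = (9 * n' ^+ 2) * 3) //; ring.
have c3m : coprimez 3 (m ^+ 3).
  by rewrite -mE (_ : 27 * n' ^+ 2 = (9 * n' ^+ 2) * 3) //; ring.
have yE' : y = 9 * n ^+ 3 - x by rewrite yE kE' nE; ring.
pose th := Eis (x - 3 * n ^+ 3) (3 * n ^+ 3).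
have thN : eis_norm th = m ^+ 3 by rewrite /eis_norm /= -mE nE yE'; ring.
have [[s t] /= st] := coprimezP _ _ c9.
(* 1 + 2 w is a square root of -3, and th - conj(th) = 3 n^3 (1 + 2 w). Hence (1 + 2 w) (conj(th) -
   th) = 9 n^3, and the relation between 9 n^3 and m^3 = th conj(th) makes th and its conjugate
   coprime. *)
pose w2 := Eis 1 2.
have cop : (Eis t 0 * eis_conj th - Eis s 0 * w2) * th + (Eis s 0 * w2) * eis_conj th = 1.
  apply: eisP; last by rewrite !eisE /=; ring.
  rewrite [RHS](_ : _ = s * (9 * n ^+ 3) + t * eis_norm th); last by rewrite thN.
  by rewrite !eisE /eis_norm /=; ring.
have prd : th * eis_conj th = (Eis m 0) ^+ 3.
  rewrite eis_mul_conj thN eis_cube; apply: eisP => /=; ring.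
have [de [a [b [p [q [dE tE mdE]]]]]] := eis_bezout th (Eis m 0).
have [k1 [k2 [h1 h2]]] := coprime_mul_cube prd cop dE tE mdE.
have m0 : eis_norm th != 0.
  rewrite thN -mE; apply: contra_neq z'0 => h.
  by move/eqP: E2; rewrite h mulr0 expf_eq0 /= => /eqP.
have k21 : k2 * k1 = 1.
  have h : th * (k2 * k1 - 1) = 0 by rewrite mulrBr mulr1 mulrCA -h1 -h2 subrr.
  have := congr1 eis_norm h; rewrite eis_normM => /eqP.
  rewrite [eis_norm 0](_ : _ = 0) // mulf_eq0 (negPf m0) /= => /eqP /eis_norm_eq0 /eqP.
  by rewrite subr_eq0 => /eqP.
(* This excludes the units other than 1 and -1. The w-coordinates of th and of any cube are
   divisible by 3; with such a unit the first coordinate of th would be too, although its norm m^3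
   is prime to 3. *)
have no3 e f : th = Eis (3 * e) (3 * f) -> False.
  move=> thE; move: c3m; rewrite coprimez3 -thN thE => /negP; apply.
  apply/dvdzP; exists (3 * e ^+ 2 - 3 * e * f + 3 * f ^+ 2); rewrite /eis_norm /=; ring.
have th2 : th.2 = 3 * n ^+ 3 by [].
have [[c d] cd] : exists g, th = g ^+ 3.
  pose c := de.1; pose d := de.2.
  rewrite eis_cube -/c -/d in h2.
  have t2 := congr1 snd h2; rewrite th2 eis_mul2E /= in t2.
  case: (eis_unit k21) => [] [] kE2; rewrite kE2 /= in t2.
  - by exists de; rewrite eis_cube h2 kE2; apply: eisP; rewrite !eisE /=; ring.
  - by exists (- de); rewrite exprNn eis_cube h2 kE2; apply: eisP; rewrite !eisE /=; ring.
  - case: (no3 (- (c * d * (c - d))) (n ^+ 3)); apply: eisP => //.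
    by rewrite h2 kE2 !eisE /=; ring.
  - case: (no3 (c * d * (c - d)) (n ^+ 3)); apply: eisP => //.
    by rewrite h2 kE2 !eisE /=; ring.
  - case: (no3 (n ^+ 3 - c * d * (c - d)) (n ^+ 3)); apply: eisP => //.
    by rewrite [RHS]mulrBr t2 h2 kE2 !eisE /=; ring.
  - case: (no3 (n ^+ 3 + c * d * (c - d)) (n ^+ 3)); apply: eisP => //.
    by rewrite [RHS]mulrDr t2 h2 kE2 !eisE /=; ring.
have E3 : n ^+ 3 = c * (d * (c - d)).
  apply: (@mulfI _ (3 : int)) => //; have := congr1 snd cd; rewrite eis_cube th2 /= => ->.
  by ring.
have E4 : m ^+ 3 = (c ^+ 2 - c * d + d ^+ 2) ^+ 3.
  by rewrite -thN cd !exprS expr0 mulr1 !eis_normM /eis_norm /=; ring.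
have ccd : coprimez c d.
  pose Q := (c ^+ 2 - c * d + d ^+ 2) ^+ 2.
  apply/coprimezP; exists (9 * s * (d * (c - d)) + t * (c - d) * Q, t * d * Q) => /=.
  by rewrite -[RHS]st E3 E4 /Q; ring.
have cdd : coprimez d (c - d).
  by rewrite /coprimez (_ : c - d = (-1) * d + c) ?gcdzMDl -?/(coprimez _ _) 1?coprimez_sym //; ring.
have ccc : coprimez c (c - d).
  by rewrite /coprimez (_ : c - d = 1 * c + - d) ?gcdzMDl ?gcdzN //; ring.
have [r rE] : exists r, c = r ^+ 3.
  by apply: (@int_coprime_cube _ (d * (c - d)) n); rewrite ?coprimezMr ?ccd.
have [r2 r2E] : exists r, d = r ^+ 3.
  apply: (@int_coprime_cube _ (c * (c - d)) n); last by rewrite E3; ring.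
  by rewrite coprimezMr coprimez_sym ccd.
have [r3 r3E] : exists r, c - d = r ^+ 3.
  apply: (@int_coprime_cube _ (c * d) n); last by rewrite E3; ring.
  by rewrite coprimezMr ![coprimez (c - d) _]coprimez_sym ccc cdd.
exists r, r2, r3.
have nr : (r * r2 * r3) ^+ 3 = n ^+ 3 by rewrite E3 r3E rE r2E; ring.
have abs3 (i j : int) : i ^+ 3 = j ^+ 3 -> absz i = absz j.
  by move=> /(congr1 absz) /eqP; rewrite !abszX eqn_exp2r // => /eqP.
have n0 : n != 0.
  apply: contra_neq z'0 => n0.
  by move/eqP: E2; rewrite nE n0 expr0n mul0r expf_eq0 /= => /eqP.
have m1 : m != 0 by apply: contra_neq m0 => m1; rewrite thN m1.
have zn : absz z' = absz (n * m) by apply: abs3; rewrite E2 mE nE; ring.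
split.
- by move: cdd; rewrite r3E r2E coprimez_pexpl // coprimez_pexpr.
- by rewrite -r2E -r3E -rE; ring.
- by rewrite -absz_eq0 (abs3 _ _ nr) absz_eq0.
(* Here |r s t| = |n| while |z| = 3 |n m|. *)
rewrite (abs3 _ _ nr) zE abszM zn abszM; move: n0 m1; rewrite -!absz_eq0.
move: (absz n) (absz m) => i j; rewrite -!lt0n => i0 j0; clear -i0 j0; rewrite (_ : absz 3 = 3%N) //; nia.
Qed.

(** Infinite descent on |x y z|. If 3 divides one of the variables, changes of sign bring it to the
    right-hand side, as [fermat3_descent] requires; otherwise all three cubes are 1 or -1 modulo 9,
    and the equation fails modulo 9. *)
Lemma fermat3_coprime (x y z : int) : coprimez x y -> x ^+ 3 + y ^+ 3 = z ^+ 3 ->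
  x * y * z = 0.
Proof.
have [N] := ubnP (absz (x * y * z)); elim: N x y z => // N IH x y z hN cxy h.
apply/eqP; apply: contraT => xyz0.
have step a b c : coprimez a b -> (3 %| c)%Z -> a ^+ 3 + b ^+ 3 = c ^+ 3 ->
    absz (a * b * c) = absz (x * y * z) -> False.
  move=> cab c3 abc habs.
  have abc0 : a * b * c != 0 by rewrite -absz_eq0 habs absz_eq0.
  have c0 : c != 0 by apply: contra_neq abc0 => ->; rewrite mulr0.
  have [r [s [t [cst e nz lt]]]] := fermat3_descent cab c3 c0 abc.
  suff: s * t * r = 0.
    by move=> e0; case/eqP: nz; rewrite -[RHS]e0; ring.
  apply: IH => //; apply: leq_trans (_ : absz c <= N)%N.
    by rewrite (_ : s * t * r = r * s * t) //; ring.
  move: hN; rewrite -habs abszM ltnS; apply: leq_trans; apply: leq_pmull.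
  rewrite lt0n absz_eq0; apply: contra_neq abc0 => ->; exact: mul0r.
have czy : coprimez z (- y).
  rewrite -(coprimez_pexpl (k := 3)) // -h coprimezN coprimez_sym /coprimez.
  rewrite (_ : x ^+ 3 + y ^+ 3 = y ^+ 2 * y + x ^+ 3) ?gcdzMDl -?/(coprimez _ _); last by ring.
  by rewrite coprimez_pexpr // coprimez_sym.
have czx : coprimez z (- x).
  rewrite -(coprimez_pexpl (k := 3)) // -h coprimezN coprimez_sym /coprimez.
  rewrite (_ : x ^+ 3 + y ^+ 3 = x ^+ 2 * x + y ^+ 3) ?gcdzMDl -?/(coprimez _ _); last by ring.
  by rewrite coprimez_pexpr.
case: (boolP (3 %| z)%Z) => [z3 | /cube_mod9 [k hk]].
  by case: (step x y z).
case: (boolP (3 %| x)%Z) => [x3 | /cube_mod9 [i hi]].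
  case: (step z (- y) x) => //; first by rewrite exprNn -h; ring.
  by rewrite -abszN; congr absz; ring.
case: (boolP (3 %| y)%Z) => [y3 | /cube_mod9 [j hj]].
  case: (step z (- x) y) => //; first by rewrite exprNn -h; ring.
  by rewrite -abszN; congr absz; ring.
by move: h hi hj hk; move: (x ^+ 3) (y ^+ 3) (z ^+ 3) => X Y Z; clear; lia.
Qed.

Lemma fermat3_int (x y z : int) : x ^+ 3 + y ^+ 3 = z ^+ 3 -> x * y * z = 0.
Proof.
move=> h; case: (eqVneq x 0) => [->|x0]; first by rewrite !mul0r.
have g0 : gcdz x y != 0 by rewrite gcdz_eq0 (negPf x0).
have /dvdzP [a aE] := dvdz_gcdl x y; have /dvdzP [b bE] := dvdz_gcdr x y.
set g := gcdz x y in g0 aE bE.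
have /dvdzP [c cE] : (g %| z)%Z.
  rewrite -(@dvdz_pexp2r _ _ 3) // -h aE bE !exprMn -mulrDl; exact: dvdz_mull.
have cab : coprimez a b.
  have [u [v uv]] := Bezoutz x y; apply/coprimezP; exists (u, v) => /=.
  by apply: (mulIf g0); rewrite mul1r -[RHS]uv [in RHS]aE [in RHS]bE; ring.
have: a * b * c = 0.
  apply: fermat3_coprime => //; apply: (mulIf (expf_neq0 3 g0)).
  by rewrite mulrDl -!exprMn -aE -bE -cE.
by move=> abc; rewrite aE bE cE; transitivity (a * b * c * g ^+ 3); [ring | rewrite abc mul0r].
Qed.

Lemma fermat3_rat (x y z : rat) : x ^+ 3 + y ^+ 3 = z ^+ 3 -> x * y * z = 0.
Proof.
pose D := (denq x * denq y * denq z)%:~R : rat.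
have d0 (r : rat) : (denq r)%:~R != 0 :> rat by rewrite intr_eq0 denq_neq0.
have D0 : D != 0 by rewrite /D !rmorphM /= !mulf_neq0.
have rE (r : rat) : r * (denq r)%:~R = (numq r)%:~R.
  by rewrite -{1}(divq_num_den r) divfK.
have xE : x * D = (numq x * denq y * denq z)%:~R by rewrite /D !rmorphM /= -rE; ring.
have yE : y * D = (numq y * denq x * denq z)%:~R by rewrite /D !rmorphM /= -rE; ring.
have zE : z * D = (numq z * denq x * denq y)%:~R by rewrite /D !rmorphM /= -rE; ring.
move=> h; apply: (mulIf (expf_neq0 3 D0)).
transitivity (x * D * (y * D) * (z * D)); first by ring.
rewrite mul0r xE yE zE -!rmorphM /=; apply/eqP; rewrite intr_eq0; apply/eqP.
apply: fermat3_int; apply: (@intr_inj rat).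
by rewrite rmorphD /= !rmorphXn /= -xE -yE -zE !exprMn -mulrDl h.
Qed.

(** * Cubes in the field of cube roots of unity *)

Lemma cube_rat_inj (x y : rat) : x ^+ 3 = y ^+ 3 -> x = y.
Proof.
move=> h; have: (x - y) * (x ^+ 2 + x * y + y ^+ 2) = 0.
  by transitivity (x ^+ 3 - y ^+ 3); [ring | rewrite h subrr].
move/eqP; rewrite mulf_eq0 => /orP [|/eqP e]; first by rewrite subr_eq0 => /eqP.
have /eqP : y ^+ 2 = 0 by have := sqr_ge0 (2 * x + y); have := sqr_ge0 y; nra.
rewrite sqrf_eq0 => /eqP y0; rewrite y0 in e *; apply/eqP.
by rewrite -sqrf_eq0 -[X in _ == X]e; apply/eqP; ring.
Qed.

(* The right hand side is (1 - 3 V) ^ 3 + (3 V) ^ 3. *)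
Lemma alpha_norm_cube (V y : rat) : y ^+ 3 = 1 - 9 * V + 27 * V ^+ 2 -> V = 0 \/ 3 * V = 1.
Proof.
move=> h; have: (1 - 3 * V) * (3 * V) * y = 0.
  by apply: fermat3_rat; rewrite h; ring.
move/eqP; rewrite !mulf_eq0 => /orP [/orP []|] /eqP e.
- by right; lra.
- by left; move: e; lra.
by move: h; rewrite e expr0n /=; nra.
Qed.

Section Quadratic.
Variables (L : fieldExtType rat) (W : L) (v : rat).
Hypotheses (W1 : W ^+ 2 + W + 1 = 0) (v0 : v != 0).

Let W2E : W ^+ 2 = - W - 1.
Proof. by apply/eqP; rewrite -subr_eq0 -W1; apply/eqP; ring. Qed.

Definition eltW (p q : rat) : L := in_alg L p + in_alg L q * W.

Lemma eltW_inj p q p' q' : eltW p q = eltW p' q' -> p = p' /\ q = q'.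
Proof.
pose f : {rmorphism rat -> L} := in_alg L.
rewrite /eltW => h.
have h1 : f (q - q') * W = f (p' - p).
  rewrite !rmorphB; apply/eqP; rewrite -subr_eq0; apply/eqP.
  rewrite -[RHS](subrr (f p' + f q' * W)) -{1}h; ring.
have qq : q - q' = 0.
  apply/eqP; apply: contraT => q0; case: (@no_rat_cube_root1 ((p' - p) / (q - q'))).
  apply: (fmorph_inj f); rewrite rmorph0 -[RHS]W1.
  have -> : W = f ((p' - p) / (q - q')).
    by rewrite fmorph_div -h1 mulrAC divff ?mul1r // fmorph_eq0.
  by rewrite !rmorphD rmorphXn rmorph1.
split; last by apply/eqP; rewrite -subr_eq0 qq.
move: h1; rewrite qq rmorph0 mul0r => /esym/eqP.
by rewrite fmorph_eq0 subr_eq0 => /eqP.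
Qed.

Lemma eltW_cube p q : eltW p q ^+ 3 =
  eltW (p ^+ 3 + q ^+ 3 - 3 * p * q ^+ 2) (3 * (p * q * (p - q))).
Proof. by rewrite /eltW; ring: W2E. Qed.

Lemma eltWM p q p' q' : eltW p q * eltW p' q' =
  eltW (p * p' - q * q') (p * q' + q * p' - q * q').
Proof. by rewrite /eltW; ring: W2E. Qed.

Definition alphaL : L := 1 - 3 * (1 - W) / in_alg L v.
Definition betaL : L := 1 - 3 * (1 - W ^+ 2) / in_alg L v.

Lemma alphaLE : alphaL = eltW (1 - 3 / v) (3 / v).
Proof.
by rewrite /alphaL /eltW rmorphB !fmorph_div rmorph1 !rmorph_nat; ring.
Qed.

Lemma betaLE : betaL = eltW (1 - 6 / v) (- (3 / v)).
Proof.
by rewrite /betaL /eltW W2E rmorphB rmorphN !fmorph_div rmorph1 !rmorph_nat; ring.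
Qed.

Lemma eltW_eq0 p q : eltW p q = 0 -> p = 0 /\ q = 0.
Proof.
by move=> h; apply: eltW_inj; rewrite h /eltW rmorph0 mul0r addr0.
Qed.

Lemma alphaL_neq0 : alphaL != 0.
Proof.
apply/eqP; rewrite alphaLE => /eltW_eq0 [_ /eqP].
by rewrite mulf_eq0 invr_eq0 (negPf v0).
Qed.

Lemma betaL_neq0 : betaL != 0.
Proof.
apply/eqP; rewrite betaLE => /eltW_eq0 [_ /eqP].
by rewrite oppr_eq0 mulf_eq0 invr_eq0 (negPf v0).
Qed.

Lemma alphaL_neq_betaL : alphaL != betaL.
Proof.
apply/eqP; rewrite alphaLE betaLE => /eltW_inj [_ h].
have: v^-1 = 0 by lra.
by move/eqP; rewrite invr_eq0 (negPf v0).
Qed.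

Lemma norm_cube_absurd (y : rat) : v != 3 ->
  y ^+ 3 = 1 - 9 * v^-1 + 27 * v^-1 ^+ 2 -> False.
Proof.
move=> v3 /alpha_norm_cube [/eqP|h].
  by rewrite invr_eq0 (negPf v0).
by case/eqP: v3; transitivity (3 / v * v); [rewrite h mul1r | rewrite divfK].
Qed.

Lemma alphaL_not_cube p q : v != 3 -> eltW p q ^+ 3 <> alphaL.
Proof.
move=> v3; rewrite eltW_cube alphaLE => /eltW_inj [h1 h2].
apply: (@norm_cube_absurd (p ^+ 2 - p * q + q ^+ 2)) => //.
pose R := p ^+ 3 + q ^+ 3 - 3 * p * q ^+ 2; pose S := 3 * (p * q * (p - q)).
transitivity (R ^+ 2 - R * S + S ^+ 2); first by rewrite /R /S; ring.
by rewrite /R /S h1 h2; ring.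
Qed.

Lemma betaL_not_cube p q : v != 3 -> eltW p q ^+ 3 <> betaL.
Proof.
move=> v3; rewrite eltW_cube betaLE => /eltW_inj [h1 h2].
apply: (@norm_cube_absurd (p ^+ 2 - p * q + q ^+ 2)) => //.
pose R := p ^+ 3 + q ^+ 3 - 3 * p * q ^+ 2; pose S := 3 * (p * q * (p - q)).
transitivity (R ^+ 2 - R * S + S ^+ 2); first by rewrite /R /S; ring.
by rewrite /R /S h1 h2; ring.
Qed.

(** The product is rational, and p + q W has a rational cube only if p q (p - q) = 0, that is, if it
    is a rational times 1, W or 1 + W = - W^2. Its cube is then a rational cube. *)
Lemma norm_not_cube p q : v != 3 -> eltW p q ^+ 3 <> alphaL * betaL.
Proof.
move=> v3; rewrite eltW_cube alphaLE betaLE eltWM => /eltW_inj [h1 h2].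
have {}h1 : p ^+ 3 + q ^+ 3 - 3 * p * q ^+ 2 = 1 - 9 * v^-1 + 27 * v^-1 ^+ 2.
  by rewrite h1; ring.
have /eqP : p * q * (p - q) = 0.
  apply: (@mulfI _ (3 : rat)) => //; rewrite h2; ring.
rewrite !mulf_eq0 subr_eq0 => /orP [/orP []|] /eqP e; rewrite e in h1.
- by apply: (@norm_cube_absurd q) => //; rewrite -h1; ring.
- by apply: (@norm_cube_absurd p) => //; rewrite -h1; ring.
- by apply: (@norm_cube_absurd (- q)) => //; rewrite -h1; ring.
Qed.

(* Hilbert 90: b = c / c' with c' = 1 + conj b the conjugate of c, so that alphaL c' ^ 3
   is rational; the vanishing of its W-coordinate expresses v through the coordinates of c'. *)
Lemma eta_of_quotient_cube p q : alphaL = betaL * eltW p q ^+ 3 -> in_eta v.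
Proof.
move=> h.
(* Conjugates have equal norms, so the norm of (p + q W)^3 is 1, and a rational number whose cube is
   1 is 1. *)
have N1 : p ^+ 2 - p * q + q ^+ 2 = 1.
  move: h; rewrite alphaLE betaLE eltW_cube eltWM => /eltW_inj [h1 h2].
  apply: cube_rat_inj; rewrite expr1n.
  pose R := p ^+ 3 + q ^+ 3 - 3 * p * q ^+ 2; pose S := 3 * (p * q * (p - q)).
  pose n := 1 - 9 * v^-1 + 27 * v^-1 ^+ 2.
  have n0 : n != 0 by apply/eqP; rewrite /n; have := sqr_ge0 (6 * v^-1 - 1); nra.
  apply: (mulfI n0); rewrite mulr1.
  transitivity (((1 - 6 / v) * R - - (3 / v) * S) ^+ 2
    - ((1 - 6 / v) * R - - (3 / v) * S) * ((1 - 6 / v) * S + - (3 / v) * R - - (3 / v) * S)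
    + ((1 - 6 / v) * S + - (3 / v) * R - - (3 / v) * S) ^+ 2).
    by rewrite /n /R /S; ring.
  by rewrite -h1 -h2 /n; ring.
have [r [s [rs0 hrs]]] : exists r s : rat, (r, s) <> (0, 0) /\
    eltW p q * eltW r s = eltW (r - s) (- s).
  case: (eqVneq (eltW (1 + p - q) (- q)) 0) => [/eltW_eq0 [e1 e2] | nz].
    exists 1, 2; split=> //; rewrite eltWM; congr eltW; lra.
  exists (1 + p - q), (- q); split.
    by case=> e1 e2; case/eqP: nz; rewrite e1 e2 /eltW rmorph0 mul0r addr0.
  by rewrite eltWM; congr eltW; move: N1; nra.
pose R := r ^+ 3 + s ^+ 3 - 3 * r * s ^+ 2; pose S := 3 * (r * s * (r - s)).
have E : alphaL * eltW r s ^+ 3 = betaL * eltW (r - s) (- s) ^+ 3.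
  by rewrite h -hrs; ring.
have key : (v - 6) * S + 3 * R = 0.
  move: E; rewrite alphaLE betaLE !eltW_cube !eltWM => /eltW_inj [_ h2].
  have h3 : (1 - 6 / v) * S + 3 / v * R = 0 by move: h2; rewrite /R /S; nra.
  transitivity (v * ((1 - 6 / v) * S + 3 / v * R)); last by rewrite h3 mulr0.
  by field.
have S0 : r * s * (r - s) != 0.
  apply/eqP => S0; apply: rs0.
  have R0 : r ^+ 3 + s ^+ 3 - 3 * r * s ^+ 2 = 0 by move: key; rewrite /S S0 /R; lra.
  move/eqP: S0; rewrite !mulf_eq0 subr_eq0 => /orP [/orP []|] /eqP e; rewrite e in R0 *.
  - have /eqP: s ^+ 3 = 0 by rewrite -[RHS]R0; ring.
    by rewrite expf_eq0 => /eqP ->.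
  - have /eqP: r ^+ 3 = 0 by rewrite -[RHS]R0; ring.
    by rewrite expf_eq0 => /eqP ->.
  - have /eqP: (- s) ^+ 3 = 0 by rewrite -[RHS]R0; ring.
    by rewrite expf_eq0 oppr_eq0 => /eqP ->.
move: (S0); rewrite !mulf_eq0 !negb_or => /andP [/andP [r0 s0] rs].
(* [key] is linear in v, with solution 6 - R / (r s (r - s)); this depends only on r / s and becomes
   eta(u) at r / s = 1 - u. *)
exists (1 - r / s); split; [|split].
- apply/eqP => e; case/eqP: rs; transitivity (- s * (1 - r / s)); first by field.
  by rewrite e mulr0.
- apply/eqP => e; have: r / s = 0 by lra.
  by move/eqP; rewrite mulf_eq0 invr_eq0 (negPf r0) (negPf s0).
have vE : v = 6 - R / (r * s * (r - s)).
  apply: (@mulIf _ (3 * (r * s * (r - s)))); first by rewrite mulf_neq0.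
  transitivity (6 * (3 * (r * s * (r - s))) - 3 * R); last by field; rewrite r0 s0 rs.
  by move: key; rewrite /S; lra.
have e1 : s - r + -1 * s = - r by ring.
by rewrite vE /R; field; rewrite s0 rs r0 e1 oppr_eq0 r0 -opprB oppr_eq0 rs.
Qed.

(** The witness d = 1 - u is the ratio r / s of [eta_of_quotient_cube], normalised by s = 1. *)
Lemma quotient_cube_of_eta : in_eta v -> exists d : rat,
  alphaL * eltW d 1 ^+ 3 = betaL * eltW (d - 1) (- 1) ^+ 3.
Proof.
move=> [u [u0 [u1 vE]]]; exists (1 - u).
have nz : u * (u - 1) != 0 by rewrite mulf_neq0 // subr_eq0.
have hv : v * (u * (u - 1)) = u ^+ 3 + 3 * u ^+ 2 - 6 * u + 1 by rewrite vE divfK.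
pose d := 1 - u.
have key : (v - 6) * (3 * (d * 1 * (d - 1))) + 3 * (d ^+ 3 + 1 ^+ 3 - 3 * d * 1 ^+ 2) = 0.
  transitivity (3 * (v * (u * (u - 1)) - (u ^+ 3 + 3 * u ^+ 2 - 6 * u + 1))).
    by rewrite /d; ring.
  by rewrite hv subrr mulr0.
rewrite -/d alphaLE betaLE !eltW_cube !eltWM; congr eltW.
  apply/eqP; rewrite -subr_eq0; apply/eqP.
  rewrite -[RHS](mulr0 (v^-1)) -key; field; exact: v0.
apply/eqP; rewrite -subr_eq0; apply/eqP.
rewrite -[RHS](mulr0 (2 / v)) -key; field; exact: v0.
Qed.

End Quadratic.

(** * The Galois group *)

Lemma tperm_pt_val (a b : nat) (i : 'I_6) : (a.-1 < 6)%N -> (b.-1 < 6)%N ->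
  tperm (pt a) (pt b) i = (if i == a.-1 :> nat then b.-1
    else if i == b.-1 :> nat then a.-1 else i) :> nat.
Proof.
move=> ha hb; rewrite permE /= -!val_eqE /= /pt !inordK //.
by case: ifP => _; [rewrite inordK | case: ifP => // _; rewrite inordK].
Qed.

Lemma gW_val (i : 'I_6) : gW i = nth 0%N [:: 1; 2; 0; 4; 5; 3]%N i :> nat.
Proof.
by rewrite /gW !permM !tperm_pt_val //; case: i => [[|[|[|[|[|[|]]]]]]].
Qed.

Lemma gC1_val (i : 'I_6) : gC1 i = nth 0%N [:: 5; 3; 4; 1; 2; 0]%N i :> nat.
Proof.
by rewrite /gC1 !permM !tperm_pt_val //; case: i => [[|[|[|[|[|[|]]]]]]].
Qed.

Lemma gC2_val (i : 'I_6) : gC2 i = nth 0%N [:: 1; 2; 0; 5; 3; 4]%N i :> nat.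
Proof.
by rewrite /gC2 !permM !tperm_pt_val //; case: i => [[|[|[|[|[|[|]]]]]]].
Qed.

(* A permutation commuting with gW is determined by the images of the points 1 and 4,
   which lie in different orbits of gW. *)
Lemma card_Wgrp : (#|Wgrp| <= 18)%N.
Proof.
pose o0 : 'I_6 := ord0; pose o3 : 'I_6 := inord 3.
pose f (s : {perm 'I_6}) : bool * 'I_3 * 'I_3 :=
  ((s o0 < 3)%N, inord (s o0 %% 3), inord (s o3 %% 3)).
suff inj : {in Wgrp &, injective f}.
  have -> : 18%N = #|{: bool * 'I_3 * 'I_3}| by rewrite !card_prod card_bool !card_ord.
  by rewrite -(card_in_imset inj) max_card.
have o3E : o3 = 3%N :> nat by rewrite inordK.
have orb (i j : 'I_6) : (i < 3)%N = (j < 3)%N -> [\/ j = i, j = gW i | j = gW (gW i)].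
  move=> h; suff: [|| j == i, j == gW i | j == gW (gW i)].
    by case/or3P=> /eqP h'; [apply: Or31 | apply: Or32 | apply: Or33].
  rewrite -!val_eqE /= !gW_val; move: h.
  by case: i => [[|[|[|[|[|[|]]]]]]] //= _; case: j => [[|[|[|[|[|[|]]]]]]].
have com (s : {perm 'I_6}) i : s \in Wgrp -> s (gW i) = gW (s i).
  by move=> /cent1P h; rewrite -!permM h.
have blk (s : {perm 'I_6}) : s \in Wgrp -> (s o3 < 3)%N = ~~ (s o0 < 3)%N.
  move=> sW; case: (eqVneq (s o0 < 3)%N (s o3 < 3)%N); last by do 2 case: (_ < 3)%N.
  by case/orb; rewrite -?com // => /perm_inj /(congr1 val); rewrite /= !(o3E, gW_val).
have val_eq (i j : 'I_6) : (i < 3)%N = (j < 3)%N -> (i %% 3 = j %% 3)%N -> i = j.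
  move=> h1 h2; apply: val_inj => /=; move: h1 h2.
  by case: i => [[|[|[|[|[|[|]]]]]]] //= _; case: j => [[|[|[|[|[|[|]]]]]]].
move=> s t sW tW [e1 /(congr1 val) e2 /(congr1 val) e3].
rewrite /= !inordK ?ltn_mod // in e2 e3.
have E0 : s o0 = t o0 by apply: val_eq.
have E3 : s o3 = t o3 by apply: val_eq => //; rewrite !blk // e1.
apply/permP => i.
have [/orb | /orb] : (o0 < 3)%N = (i < 3)%N \/ (o3 < 3)%N = (i < 3)%N.
- by rewrite o3E; case: (i < 3)%N; [left | right].
- by case=> ->; rewrite ?com // E0.
- by case=> ->; rewrite ?com // E3.
Qed.

(** * Galois action on the six cube roots *)

Section Galois.
Variables (L : splittingFieldType rat) (K : {subfield L}) (v : rat) (W A B : L).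
Hypotheses (v0 : v != 0) (KW : W \in K) (KA : A \in K) (KB : B \in K).
Hypothesis K_min : forall E : {subfield L}, W \in E -> A \in E -> B \in E -> (K <= E)%VS.
Hypotheses (W1 : W ^+ 2 + W + 1 = 0) (A3 : A ^+ 3 = alphaL W v) (B3 : B ^+ 3 = betaL W v).
Local Notation G := ('Gal(K / 1%AS))%g.
Local Notation QW := <<1%VS; W>>%AS.
Local Notation N := ('Gal(K / QW))%g.

Let W2E : W ^+ 2 = - W - 1.
Proof. by apply/eqP; rewrite -subr_eq0 -W1; apply/eqP; ring. Qed.

Let A0 : A != 0.
Proof. by apply/eqP => h; case/eqP: (alphaL_neq0 W1 v0); rewrite -A3 h expr0n. Qed.

Let B0 : B != 0.
Proof. by apply/eqP => h; case/eqP: (betaL_neq0 W1 v0); rewrite -B3 h expr0n. Qed.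

Let W0 : W != 0.
Proof. by apply/eqP => h; move/eqP: W1; rewrite h expr0n /= !add0r oner_eq0. Qed.

Lemma W_not_rat k : W <> in_alg L k.
Proof.
move=> h; have: eltW W 0 1 = eltW W k 0 by rewrite /eltW rmorph0 rmorph1 mul1r add0r mul0r addr0.
by move/(eltW_inj W1) => [_ /eqP]; rewrite oner_eq0.
Qed.

Let W_neq1 : W != 1.
Proof. by apply/eqP => h; apply: (@W_not_rat 1); rewrite rmorph1. Qed.

Let W_neqV : W != W ^+ 2.
Proof.
apply/eqP => h; case/eqP: W_neq1; apply: (mulfI W0); by rewrite mulr1 -expr2.
Qed.

Lemma cube_roots_eqL (a u : L) : u ^+ 3 = a ^+ 3 -> exists i : 'I_3, u = W ^+ i * a.
Proof.
move=> h; have: (u - a) * ((u - W * a) * (u - W ^+ 2 * a)) = 0.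
  by transitivity (u ^+ 3 - a ^+ 3); [ring: W2E | rewrite h subrr].
move/eqP; rewrite !mulf_eq0 !subr_eq0 => /or3P [] /eqP ->.
- by exists (inord 0); rewrite inordK // mul1r.
- by exists (inord 1); rewrite inordK.
- by exists (inord 2); rewrite inordK.
Qed.

(** The order is fitted to the given permutations: [gW] multiplies the roots of alpha by W and those
    of beta by W^2, as the quadratic map does on its 3-cycles, and [gC2] multiplies all six by W. *)
Definition roots6 : seq L := [:: A; W * A; W ^+ 2 * A; B; W ^+ 2 * B; W * B].
Definition root6 (i : 'I_6) : L := nth 0 roots6 i.

Lemma root6_cube i : root6 i ^+ 3 = if (i < 3)%N then alphaL W v else betaL W v.
Proof. by rewrite /root6; case: i => [[|[|[|[|[|[|]]]]]]] //= _; rewrite -?A3 -?B3; ring: W2E. Qed.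

Lemma root6_inj : injective root6.
Proof.
have h1 (a : L) : a != 0 -> uniq [:: a; W * a; W ^+ 2 * a].
  move=> a0; rewrite /= !inE !negb_or !andbT.
  have e (x y : L) : x != y -> x * a != y * a by apply: contra_neq => /(mulIf a0).
  rewrite -{1 3}[a]mul1r !e // 1?eq_sym //.
  apply/eqP => h; case/eqP: W_neq1; transitivity (W ^+ 2 * W ^+ 2); first by ring: W2E.
  by rewrite h mulr1.
have u6 : uniq roots6.
  have -> : roots6 = [:: A; W * A; W ^+ 2 * A] ++ [:: B; W ^+ 2 * B; W * B] by [].
  rewrite cat_uniq; apply/and3P; split; [exact: h1 | |]; last first.
    have := h1 _ B0; rewrite /= !inE !negb_or !andbT => /andP [/andP [-> ->]].
    by rewrite eq_sym => ->.
  have ne := alphaL_neq_betaL W1 v0.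
  apply/hasPn => x xB; apply/negP => xA; case/eqP: ne.
  have <- : x ^+ 3 = alphaL W v.
    by move: xA; rewrite !inE => /or3P [] /eqP ->; rewrite -A3; ring: W2E.
  by move: xB; rewrite !inE => /or3P [] /eqP ->; rewrite -B3; ring: W2E.
move=> i j /eqP; rewrite /root6 nth_uniq // => /eqP; exact: val_inj.
Qed.

(** K is the splitting field of (X^3 - alpha) (X^3 - beta), whose coefficients are rational because
    alpha and beta are conjugate; W is recovered as W A / A. *)
Lemma galois_K : galois 1 K.
Proof.
apply/and3P; split; [exact: sub1v | exact: num_field_separable |].
apply/splitting_normalField; first exact: sub1v.
pose a : {poly L} := (alphaL W v)%:P; pose b : {poly L} := (betaL W v)%:P.
exists ('X^6 - (alphaL W v + betaL W v)%:P * 'X^3 + (alphaL W v * betaL W v)%:P).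
  have h1 : alphaL W v + betaL W v \in 1%VS.
    rewrite alphaLE // betaLE // /eltW; apply/vlineP; exists (2 - 9 / v).
    have -> : (2 - 9 / v)%:A = in_alg L (2 - 9 / v) by [].
    ring.
  have h2 : alphaL W v * betaL W v \in 1%VS.
    rewrite alphaLE // betaLE // eltWM // /eltW; apply/vlineP.
    exists (1 - 9 * v^-1 + 27 * v^-1 ^+ 2).
    have -> r : r%:A = in_alg L r by [].
    ring.
  by rewrite rpredD ?polyOverC // rpredB ?polyOverXn // rpredM ?polyOverXn ?polyOverC.
exists roots6.
  suff -> : \prod_(z <- roots6) ('X - z%:P) = 'X^6 - (alphaL W v + betaL W v)%:P * 'X^3
      + (alphaL W v * betaL W v)%:P :> {poly L} by exact: eqpxx.
  rewrite -A3 -B3 /roots6 !big_cons big_nil mulr1.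
  have W2P : W%:P ^+ 2 = - W%:P - 1 :> {poly L} by rewrite -rmorphXn W2E rmorphB rmorphN rmorph1.
  by ring: W2P.
apply/eqP; rewrite eqEsubv; apply/andP; split.
  apply/Fadjoin_seqP; split; first exact: sub1v.
  move=> x; rewrite !inE => hx.
  by case/or3P: hx => [/eqP-> | /eqP-> | /or4P [] /eqP->]; rewrite ?rpredM ?rpredX.
have m x : x \in roots6 -> x \in <<1 & roots6>>%VS by apply: seqv_sub_adjoin.
have mA : A \in <<1 & roots6>>%VS by apply: m; rewrite !inE eqxx.
have mWA : W * A \in <<1 & roots6>>%VS by apply: m; rewrite !inE eqxx orbT.
have mB : B \in <<1 & roots6>>%VS by apply: m; rewrite !inE eqxx !orbT.
apply: K_min => //.
by rewrite -(mulfK A0 W); apply: rpred_div.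
Qed.

Lemma mem_galK (x : gal_of K) : x \in G.
Proof. by rewrite gal_kHom ?sub1v // k1HomE ahomWin. Qed.

Lemma gal_in_alg (x : gal_of K) r : x (in_alg L r) = in_alg L r.
Proof. by rewrite /= linearZ rmorph1. Qed.

Lemma gal_W (x : gal_of K) : {x W = W} + {x W = W ^+ 2}.
Proof.
case: (eqVneq (x W) W) => [|h]; [by left | right].
have: (x W - W) * (x W - W ^+ 2) = 0.
  transitivity (x (W ^+ 2 + W + 1)); last by rewrite W1 rmorph0.
  by rewrite !rmorphD rmorph1 rmorphXn /=; ring: W2E.
by move/eqP; rewrite mulf_eq0 !subr_eq0 (negPf h) => /eqP.
Qed.

Lemma gal_alpha (x : gal_of K) :
  x (alphaL W v) = alphaL (x W) v /\ x (betaL W v) = betaL (x W) v.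
Proof.
rewrite /alphaL /betaL !(rmorphB, fmorph_div, rmorphM, rmorph1, rmorph_nat, rmorphXn).
by have /= -> := gal_in_alg x v.
Qed.

Lemma alphaL_swap : alphaL (W ^+ 2) v = betaL W v /\ betaL (W ^+ 2) v = alphaL W v.
Proof. by rewrite /alphaL /betaL -exprM; split=> //; congr (1 - _ * (1 - _) / _); ring: W2E. Qed.

Lemma gal_root6 (x : gal_of K) (i : 'I_6) : exists j, root6 j = x (root6 i).
Proof.
have kA (u : L) : u ^+ 3 = alphaL W v -> exists j, root6 j = u.
  rewrite -A3 => /cube_roots_eqL [[[|[|[|]]] //= hk] ->].
  - by exists (inord 0); rewrite /root6 inordK //= mul1r.
  - by exists (inord 1); rewrite /root6 inordK.
  - by exists (inord 2); rewrite /root6 inordK.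
have kB (u : L) : u ^+ 3 = betaL W v -> exists j, root6 j = u.
  rewrite -B3 => /cube_roots_eqL [[[|[|[|]]] //= hk] ->].
  - by exists (inord 3); rewrite /root6 inordK //= mul1r.
  - by exists (inord 5); rewrite /root6 inordK.
  - by exists (inord 4); rewrite /root6 inordK.
have := congr1 x (root6_cube i); rewrite rmorphXn /=.
have [hA hB] := gal_alpha x; have [sA sB] := alphaL_swap.
by case: ifP => _; rewrite ?hA ?hB; case: (gal_W x) => ->; rewrite ?sA ?sB; auto.
Qed.

Definition gal6_fun (x : gal_of K) (i : 'I_6) : 'I_6 :=
  odflt ord0 [pick j | root6 j == x (root6 i)].

Lemma gal6_funE x i : root6 (gal6_fun x i) = x (root6 i).
Proof.
rewrite /gal6_fun; case: pickP => [j /eqP //|h].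
by have [j hj] := gal_root6 x i; move: (h j); rewrite hj eqxx.
Qed.

Lemma gal6_fun_inj x : injective (gal6_fun x).
Proof.
by move=> i j /(congr1 root6); rewrite !gal6_funE => /fmorph_inj /root6_inj.
Qed.

Definition gal6 (x : gal_of K) : {perm 'I_6} := perm (@gal6_fun_inj x).

Lemma gal6E x i : root6 (gal6 x i) = x (root6 i).
Proof. by rewrite permE gal6_funE. Qed.

Lemma root6_in i : root6 i \in K.
Proof.
by rewrite /root6; case: i => [[|[|[|[|[|[|]]]]]]] //= _; rewrite ?rpredM ?rpredX.
Qed.

Lemma gal6M : {in G &, {morph gal6 : x y / (x * y)%g}}.
Proof.
move=> x y _ _; apply/permP => i; apply: root6_inj.
by rewrite permM !gal6E galM // root6_in.
Qed.

Canonical gal6_morphism := Morphism gal6M.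

Lemma gal_fixed1 (x : gal_of K) : x W = W -> x A = A -> x B = B -> x = 1%g.
Proof.
move=> xW xA xB.
have fixE a : a \in K -> x a = a -> a \in fixedField [set x].
  by move=> aK xa; apply/fixedFieldP => // y /set1P ->.
have sub : (K <= fixedField [set x])%VS by apply: K_min; apply: fixE.
by apply/eqP/gal_eqP => a Ka; rewrite gal_id; have /mem_fixedFieldP [_] := subvP sub a Ka;
  apply; rewrite set11.
Qed.

Lemma gal6_injm : ('injm gal6_morphism)%g.
Proof.
apply/subsetP => x /mker /= h; apply/set1P.
have fx i : x (root6 i) = root6 i by rewrite -gal6E h perm1.
have xA : x A = A by have := fx (inord 0); rewrite /root6 inordK.
have xB : x B = B by have := fx (inord 3); rewrite /root6 inordK.
apply: gal_fixed1 => //.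
have := fx (inord 1); rewrite /root6 inordK //= rmorphM /= xA => /(mulIf A0) //.
Qed.

Lemma gal6_isog (H : {set {perm 'I_6}}) : (gal6_morphism @* G)%g = H -> (G \isog H)%g.
Proof. by move=> <-; apply: sub_isog gal6_injm. Qed.

Lemma gal_fixed_QW z : z \in K -> (forall x, x \in N -> x z = z) -> exists p q, z = eltW W p q.
Proof.
move=> Kz fz.
have sQK : (1%AS <= QW <= K)%VS.
  by rewrite sub1v; apply/FadjoinP; rewrite sub1v.
have gQ : galois QW K by apply: galoisS galois_K.
have : z \in fixedField N by apply/fixedFieldP.
move/galois_fixedField: gQ => -> /Fadjoin_polyP [p /polyOverP p1 ->].
rewrite horner_coef.
apply: (big_ind (fun y => exists a b, y = eltW W a b)).
- by exists 0, 0; rewrite /eltW !rmorph0 mul0r addr0.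
- move=> _ _ [a [b ->]] [c [d ->]]; exists (a + c), (b + d).
  by rewrite /eltW !rmorphD; ring.
move=> i _; have /vlineP [k ->] := p1 i.
have [a [b ->]] : exists a b, W ^+ i = eltW W a b.
  elim: (nat_of_ord i) => [|n [a [b IH]]].
    by exists 1, 0; rewrite /eltW rmorph1 rmorph0 mul0r addr0.
  by exists (- b), (a - b); rewrite exprS IH /eltW rmorphB rmorphN; ring: W2E.
exists (k * a), (k * b).
by have -> : k%:A = in_alg L k by []; rewrite /eltW !rmorphM; ring.
Qed.

Lemma galN x : (x \in N) = (x W == W).
Proof.
have sQK : (QW <= K)%VS by apply/FadjoinP; rewrite sub1v.
apply/idP/eqP => [xN | xW]; first by apply: (fixed_gal sQK xN); rewrite memv_adjoin.
have: x \in 'Gal(K / fixedField [set x])%g by rewrite gal_generated mem_gen ?set11.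
apply: subsetP; apply: galS; apply/FadjoinP; split; first exact: sub1v.
by apply/fixedFieldP => // y /set1P ->.
Qed.

Lemma gal_swap_exists : exists x : gal_of K, x W = W ^+ 2.
Proof.
case: (pickP (fun x : gal_of K => x W == W ^+ 2)) => [x /eqP | h]; first by exists x.
have: W \in fixedField G.
  by apply/fixedFieldP => // x _; case: (gal_W x) (h x) => // ->; rewrite eqxx.
move/galois_fixedField: galois_K => -> /vlineP [k e].
by case: (@W_not_rat k).
Qed.

Lemma galN_moves z : z \in K -> (forall p q, z <> eltW W p q) ->
  exists2 x : gal_of K, x W = W & x z <> z.
Proof.
move=> Kz hz.
case: (pickP (fun x : gal_of K => (x W == W) && (x z != z))) => [x /andP [/eqP xW /eqP xz] | h].
  by exists x.
have [x xN | p [q]] := gal_fixed_QW Kz; last by move/hz.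
by apply/eqP; move: (h x); rewrite -galN xN /= => /negbFE.
Qed.

Lemma root6_gW i : root6 (gW i) = (if (i < 3)%N then W else W ^+ 2) * root6 i.
Proof.
rewrite /root6 gW_val; case: i => [[|[|[|[|[|[|]]]]]]] //= _; by ring: W2E.
Qed.

Lemma root6_gC2X n i : root6 ((gC2 ^+ n)%g i) = W ^+ n * root6 i.
Proof.
have h j : root6 (gC2 j) = W * root6 j.
  rewrite /root6 gC2_val; case: j => [[|[|[|[|[|[|]]]]]]] //= _; by ring: W2E.
elim: n i => [|n IH] i; first by rewrite expg0 perm1 mul1r.
by rewrite expgSr permM h IH exprS mulrA.
Qed.

Lemma gal6_block x i : (gal6 x i < 3)%N = ((i < 3)%N == (x W == W)).
Proof.
have := root6_cube (gal6 x i); rewrite gal6E -rmorphXn /= root6_cube.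
have [hA hB] := gal_alpha x; have [sA sB] := alphaL_swap.
have ne := alphaL_neq_betaL W1 v0.
have -> : x (if (i < 3)%N then alphaL W v else betaL W v) =
   if (i < 3)%N then alphaL (x W) v else betaL (x W) v by case: ifP.
have ne' : (betaL W v == alphaL W v) = false by rewrite eq_sym (negPf ne).
have nW : (W ^+ 2 == W) = false by rewrite eq_sym (negPf W_neqV).
by case: (gal_W x) => ->; rewrite ?sA ?sB ?eqxx ?nW;
  case: (i < 3)%N; case: (gal6 x i < 3)%N => //= /eqP; rewrite ?(negPf ne) ?ne'.
Qed.

(** An automorphism that exchanges W and W^2 also exchanges the two blocks of roots, and so respects
    the multiplier by which [gW] acts on each block. *)
Lemma gal6_sub_W : (gal6_morphism @* G \subset Wgrp)%g.
Proof.
apply/subsetP => _ /morphimP [x _ _ ->]; apply/cent1P; apply/permP => i.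
rewrite [LHS]permM [RHS]permM; apply: root6_inj; rewrite root6_gW [in RHS]gal6E root6_gW rmorphM /= !gal6E.
congr (_ * _); rewrite gal6_block; case: (gal_W x) => xW; rewrite xW ?eqxx.
  by case: (i < 3)%N; rewrite ?rmorphXn /= xW.
rewrite [W ^+ 2 == W]eq_sym (negPf W_neqV); case: (i < 3)%N; rewrite ?rmorphXn /= xW //.
by ring: W2E.
Qed.

Lemma galN_A (x : gal_of K) : x W = W -> exists i : 'I_3, x A = W ^+ i * A.
Proof.
move=> xW; apply: cube_roots_eqL; have := congr1 x A3; rewrite rmorphXn /= => ->.
by have [-> _] := gal_alpha x; rewrite xW A3.
Qed.

Lemma galN_B (x : gal_of K) : x W = W -> exists i : 'I_3, x B = W ^+ i * B.
Proof.
move=> xW; apply: cube_roots_eqL; have := congr1 x B3; rewrite rmorphXn /= => ->.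
by have [_ ->] := gal_alpha x; rewrite xW B3.
Qed.

Lemma W_exp3 : W ^+ 3 = 1.
Proof. by ring: W2E. Qed.

(** An automorphism fixing W multiplies A and B by powers of W, so its cube is trivial; by Cauchy no
    prime other than 3 can divide the order. *)
Lemma galN_pgroup : pgroup 3%N N.
Proof.
apply/pgroupP => p pr_p /Cauchy [] // x; rewrite galN => /eqP xW ox.
have [i xA] := galN_A xW; have [j xB] := galN_B xW.
have x3 : (x ^+ 3 = 1)%g.
  apply: gal_fixed1; rewrite !expgS expg0 mulg1.
  - by rewrite !galM ?rpredM // !xW.
  - rewrite !galM ?memv_gal // xA !(rmorphM, rmorphXn) /= xW xA !(rmorphM, rmorphXn) /= xW xA.
    by transitivity ((W ^+ i) ^+ 3 * A); [ring | rewrite -exprM mulnC exprM W_exp3 expr1n mul1r].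
  - rewrite !galM ?memv_gal // xB !(rmorphM, rmorphXn) /= xW xB !(rmorphM, rmorphXn) /= xW xB.
    by transitivity ((W ^+ j) ^+ 3 * B); [ring | rewrite -exprM mulnC exprM W_exp3 expr1n mul1r].
have: (p %| 3)%N by rewrite -ox order_dvdn x3.
by rewrite dvdn_prime2 // => /eqP ->; rewrite inE.
Qed.

Lemma not_in_QW z c : z ^+ 3 = c -> (forall p q, eltW W p q ^+ 3 <> c) ->
  forall p q, z <> eltW W p q.
Proof. by move=> h hc p q e; apply: (hc p q); rewrite -e. Qed.

(* A cyclic N would fix one of A, B, A / B, A B, hence that element would lie in Q(W). *)
Lemma galN_not_cyclic : v != 3 -> ~ in_eta v -> ~~ (cyclic N)%g.
Proof.
move=> v3 neta; apply/negP => /cyclicP [x Nx].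
have : x \in N by rewrite Nx cycle_id.
rewrite galN => /eqP xW.
have fix_cyc z : z \in K -> x z = z -> exists p q, z = eltW W p q.
  move=> Kz xz; apply: gal_fixed_QW => // y; rewrite Nx => /cycleP [k ->].
  elim: k => [|k IH]; first by rewrite gal_id.
  by rewrite expgS galM // xz IH.
have noA : x A <> A.
  by move=> /(fix_cyc _ KA) [p [q e]]; apply: (alphaL_not_cube W1 v0 v3 (p := p) (q := q)); rewrite -e.
have noB : x B <> B.
  by move=> /(fix_cyc _ KB) [p [q e]]; apply: (betaL_not_cube W1 v0 v3 (p := p) (q := q)); rewrite -e.
have noAB : x (A * B) <> A * B.
  have KAB : A * B \in K by apply: rpredM.
  move=> /(fix_cyc _ KAB) [p [q e]]; apply: (norm_not_cube W1 v0 v3 (p := p) (q := q)).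
  by rewrite -e exprMn A3 B3.
have noAVB : x (A / B) <> A / B.
  have KAB : A / B \in K by apply: rpred_div.
  move=> /(fix_cyc _ KAB) [p [q e]]; apply: neta.
  apply: (@eta_of_quotient_cube L W v W1 v0 p q).
  by rewrite -e expr_div_n A3 B3 mulrC divfK // betaL_neq0.
have [i xA] := galN_A xW; have [j xB] := galN_B xW.
move: noA noB noAB noAVB; rewrite rmorphM fmorph_div /= xA xB.
have W3 := W_exp3; have W2 : W ^+ 2 != 0 by rewrite expf_neq0.
(* Both exponents are nonzero modulo 3: if they are equal, A / B is fixed, and otherwise they add up
   to 3 and A B is fixed. *)
case: i j {xA xB} => [[|[|[|//]]] /= _] [[|[|[|//]]] /= _]; rewrite ?expr0 ?mul1r // => _ _ h1 h2.
- by apply: h2; field; rewrite W0 B0.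
- by apply: h1; ring: W2E.
- by apply: h1; ring: W2E.
- by apply: h2; field; rewrite W0 B0.
Qed.

(** The image lies in [Wgrp], so it suffices to find 18 elements: at least 9 in N, a 3-group that is
    not cyclic, and index at least 2 because some automorphism moves W. *)
Lemma gal6_generic : v != 3 -> ~ in_eta v -> (gal6_morphism @* G)%g = Wgrp.
Proof.
move=> v3 neta; apply/eqP; rewrite eqEcard gal6_sub_W /=.
rewrite card_injm ?gal6_injm //; apply: leq_trans card_Wgrp _.
have sNG : N \subset G by apply/subsetP => x _; apply: mem_galK.
have [k cN] := p_natP galN_pgroup.
have k2 : (1 < k)%N.
  rewrite ltnNge; apply/negP => k1; case/negP: (galN_not_cyclic v3 neta).
  case: k k1 cN => [|[|//]] _ cN; last by apply: prime_cyclic; rewrite cN.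
  have /eqP := cN; rewrite expn0 -trivg_card1 => /eqP ->; exact: cyclic1.
rewrite -(Lagrange sNG) cN -[18%N]/(9 * 2)%N leq_mul //.
  by rewrite (@leq_exp2l 3 2 k).
rewrite indexg_gt1; apply/subsetPn; have [x xW] := gal_swap_exists.
by exists x; rewrite ?mem_galK // galN xW eq_sym.
Qed.

(** * The group when v is a value of eta *)

Section EtaCase.
Variable d : rat.
Hypotheses (v3 : v != 3) (AB : B * eltW W (d - 1) (- 1) = A * eltW W d 1).
Local Notation D := (eltW W d 1).
Local Notation D' := (eltW W (d - 1) (- 1)).

Let D0 : D != 0.
Proof. by apply/eqP => /(eltW_eq0 W1) [_ /eqP]; rewrite oner_eq0. Qed.

Let D'0 : D' != 0.
Proof. by apply/eqP => /(eltW_eq0 W1) [_ /eqP]; rewrite oppr_eq0 oner_eq0. Qed.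

Lemma gal_eltW (x : gal_of K) p q : x (eltW W p q) = eltW (x W) p q.
Proof.
rewrite /eltW rmorphD rmorphM.
by have /= -> := gal_in_alg x p; have /= -> := gal_in_alg x q.
Qed.

Lemma eltW_swap : eltW (W ^+ 2) d 1 = D' /\ eltW (W ^+ 2) (d - 1) (- 1) = D.
Proof. by rewrite /eltW !rmorphB !rmorphN !rmorph1; split; ring: W2E. Qed.

(** The relation [AB] gives B as an element of Q(W) times A, so an automorphism fixing W acts on
    both by the same power of W. *)
Lemma gal_etaN (x : gal_of K) (i : nat) : x W = W -> x A = W ^+ i * A -> gal6 x = (gC2 ^+ i)%g.
Proof.
move=> xW xA; have xB : x B = W ^+ i * B.
  apply: (mulIf D'0); have := congr1 x AB; rewrite !rmorphM /= !gal_eltW xW => ->.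
  by rewrite xA -!mulrA AB.
apply/permP => j; apply: root6_inj; rewrite gal6E root6_gC2X /root6.
by case: j => [[|[|[|[|[|[|]]]]]]] //= _; rewrite ?(rmorphM, rmorphXn) /= ?xW ?xA ?xB; ring.
Qed.

Lemma gal_eta_swap (x : gal_of K) : x W = W ^+ 2 -> exists i, gal6 x = (gC1 * gC2 ^+ i)%g.
Proof.
move=> xW; have [k xA] : exists k : 'I_3, x A = W ^+ k * B.
  apply: cube_roots_eqL; have := congr1 x A3; rewrite rmorphXn /= => ->.
  have [-> _] := gal_alpha x; rewrite xW B3; exact: proj1 alphaL_swap.
have xB : x B = W ^+ k * A.
  have [s1 s2] := eltW_swap.
  apply: (mulIf D0); have := congr1 x AB; rewrite !rmorphM /= !gal_eltW xW s1 s2 => ->.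
  by rewrite xA -!mulrA AB.
(* [gC1] sends A to W B, and [gC2] to the power n then gives W^(n + 1) B; this is W^k B for n = k +
   2. *)
exists (k + 2)%N; apply/permP => j; apply: root6_inj; rewrite gal6E permM root6_gC2X.
rewrite /root6 gC1_val exprD.
case: j => [[|[|[|[|[|[|]]]]]]] //= _; rewrite ?(rmorphM, rmorphXn) /= ?xW ?xA ?xB; ring: W2E.
Qed.

Lemma gal6_eta : (gal6_morphism @* G)%g = Cgrp.
Proof.
have gC2_4 : (gC2 ^+ 2 ^+ 2 = gC2)%g.
  apply/permP => j; apply: root6_inj; rewrite -expgM root6_gC2X -[gC2 in RHS]expg1 root6_gC2X.
  by ring: W2E.
have mem2 : gC2 \in (gal6_morphism @* G)%g.
  have nA := not_in_QW A3 (fun p q => alphaL_not_cube W1 v0 v3 (p := p) (q := q)).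
  have [x xW xA] := galN_moves KA nA.
  have [i xAE] := galN_A xW.
  have mx : gal6 x \in (gal6_morphism @* G)%g by apply: (mem_morphim gal6_morphism); apply: mem_galK.
  move: mx; rewrite (gal_etaN xW xAE).
  (* Exponent 0 is excluded because x moves A; for exponent 2, squaring gives back [gC2], which has
     order 3. *)
  case: i xAE => [[|[|[|//]]] /= _] xAE; first by case: xA; rewrite xAE mul1r.
    by rewrite expg1.
  by move=> mx; rewrite -gC2_4 groupX.
apply/eqP; rewrite eqEsubset gen_subG; apply/andP; split.
  have c1 : gC1 \in Cgrp by rewrite mem_gen // set21.
  have c2 : gC2 \in Cgrp by rewrite mem_gen // set22.
  apply/subsetP => _ /morphimP [x _ _ ->] /=; case: (gal_W x) => xW.
    by have [i xA] := galN_A xW; rewrite (gal_etaN xW xA) groupX.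
  by have [i ->] := gal_eta_swap xW; rewrite groupM ?groupX.
rewrite subUset !sub1set mem2 andbT.
have [x xW] := gal_swap_exists; have [i xE] := gal_eta_swap xW.
have mx : gal6 x \in (gal6_morphism @* G)%g by apply: (mem_morphim gal6_morphism); apply: mem_galK.
by move: mx; rewrite xE groupMr // groupX.
Qed.

End EtaCase.

End Galois.

Lemma gal_Q3field (v : rat) (L : splittingFieldType rat) (emb : {rmorphism L -> algC})
    (K : {subfield L}) : v != 0 -> v != 3 -> is_Q3field (phi_v v) emb K ->
  (in_eta v -> ('Gal(K / 1%AS) \isog Cgrp)%g) /\
  (~ in_eta v -> ('Gal(K / 1%AS) \isog Wgrp)%g).
Proof.
move=> v0 v3 /(Q3field_gens v0) [W [A [B [[KW KA KB Kmin] [W1]]]]].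
rewrite -alg_num_field -/(alphaL W v) -/(betaL W v) => A3 B3.
split=> [eta | neta]; last first.
  by apply: gal6_isog (gal6_generic v0 KW KA KB Kmin W1 A3 B3 v3 neta).
have [d dE] := quotient_cube_of_eta W1 v0 eta.
set D := eltW W d 1 in dE; set D' := eltW W (d - 1) (- 1) in dE.
have D'0 : D' != 0.
  by apply/eqP => /(eltW_eq0 W1) [_ /eqP]; rewrite oppr_eq0 oner_eq0.
have W2E : W ^+ 2 = - W - 1 by apply/eqP; rewrite -subr_eq0 -W1; apply/eqP; ring.
(* By [dE] this is a cube root of beta, hence B up to a power of W. It generates the same field and
   satisfies the relation of [EtaCase] exactly, which B itself need not do. *)
pose B' := A * D / D'.
have B'3 : B' ^+ 3 = betaL W v.
  by rewrite expr_div_n exprMn A3 dE mulfK // expf_neq0.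
have B'E : B' * D' = A * D by rewrite /B' divfK.
have [i BE] := cube_roots_eqL W1 (etrans B3 (esym B'3)).
have [j B'E2] := cube_roots_eqL W1 (etrans B'3 (esym B3)).
have KB' : B' \in K by rewrite B'E2 rpredM ?rpredX.
have Kmin' (E : {subfield L}) : W \in E -> A \in E -> B' \in E -> (K <= E)%VS.
  by move=> EW EA EB'; apply: Kmin => //; rewrite BE rpredM ?rpredX.
by apply: gal6_isog (gal6_eta v0 KW KA KB' Kmin' W1 A3 B'3 v3 B'E).
Qed.

Theorem theorem1p1 (phi : rfun rat) :
  is_rfun phi -> rdeg phi = 2%N ->
  (exists P : option algC,
      is_critical (ratC phi) P /\ is_periodic (rf_eval (ratC phi)) 2 P) ->
  aut_trivial (ratC phi) ->
  (exists2 v : rat, v != 0 & Qconj phi (phi_v v)) /\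
  (forall v : rat, v != 0 -> Qconj phi (phi_v v) -> v != 3 ->
     forall (L : splittingFieldType rat) (emb : {rmorphism L -> algC})
            (K : {subfield L}),
       is_Q3field phi emb K ->
       (in_eta v -> ('Gal(K / 1%AS) \isog Cgrp)%g) /\
       (~ in_eta v -> ('Gal(K / 1%AS) \isog Wgrp)%g)).
Proof.
move=> hphi d2 crit triv; split; first exact: Qconj_phi_v_exists.
move=> v v0 conj v3 L emb K hK.
exact: gal_Q3field v0 v3 (is_Q3field_conj hphi d2 v0 conj hK).
Qed.
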